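(* Let $n\geq 3$ and $d\geq 2$. The unique minimizer of $\mathcal{E}_{n}$ in $\mathcal{P}_{n}$ is a regular $n$-gon; that is, $\mathcal{E}_{n}$ attains its minimum over $\mathcal{P}_{n}$, and $p\in\mathcal{P}_{n}$ is a minimizer if and only if $p$ is a regular $n$-gon (of length $1$).
   Context: $\mathbb{S}_{1}$ is the circle of length $1$ and $d(\cdot,\cdot)$ its intrinsic (shortest arc) metric. $\mathcal{P}_{n}$ is the set of closed equilateral polygons with $n$ segments and total length $1$ in $\mathbb{R}^{d}$, parametrised by arc length, i.e. closed curves $p:\mathbb{S}_{1}\to\mathbb{R}^{d}$ with $|p'|=1$ a.e. for which there are consecutive points $a_{1},\dots,a_{n}$ on $\mathbb{S}_{1}$ (indices mod $n$) with $d(a_{i+1},a_{i})=1/n$ such that $p$ is affine on each arc $[a_{i},a_{i+1}]$. The discrete Möbius energy of $p\in\mathcal{P}_{n}$ is $$\mathcal{E}_{n}(p)=\sum_{\substack{i,j=1\\ i\neq j}}^{n}\Big(\frac{1}{|p(a_{j})-p(a_{i})|^{2}}-\frac{1}{d(a_{j},a_{i})^{2}}\Big)d(a_{i+1},a_{i})\,d(a_{j+1},a_{j})\in[0,\infty],$$ where $1/0=+\infty$. A regular $n$-gon is the boundary of a planar convex regular polygon with $n$ sides (lying in some affine $2$-plane of $\mathbb{R}^{d}$), traversed once with the points $p(a_i)$ its consecutive vertices. Uniqueness is understood up to Euclidean isometries and the choice of starting point and orientation of the parametrisation. *)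

(* Defs.v *)
From HB Require Import structures.
From mathcomp Require Import all_boot all_order all_algebra.
From mathcomp Require Import all_classical all_reals all_analysis.
From mathcomp Require Import ring lra zify.

Set Implicit Arguments.
Unset Strict Implicit.
Unset Printing Implicit Defensive.

Import Order.TTheory GRing.Theory Num.Theory.
Import numFieldNormedType.Exports.

Local Open Scope classical_set_scope.
Local Open Scope ring_scope.

(* The norm that the library puts on ['rV[R]_d] is the sup norm, hence the
   explicit Euclidean structure. *)
Definition edot {R : realType} {d : nat} (u v : 'rV[R]_d) : R :=
  \sum_(k < d) u ord0 k * v ord0 k.

Definition enorm {R : realType} {d : nat} (u : 'rV[R]_d) : R :=
  Num.sqrt (edot u u).

(* The circle of length 1 is R/Z: its points are represented by real numbers
   modulo 1 and the curves defined on it are the 1-periodic functions on R.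
   The shortest arc metric is the quotient metric. *)
Definition circle_dist {R : realType} (s t : R) : R :=
  inf [set `|s - t + k%:~R| | k in [set: int]].

Definition closed_curve {R : realType} {d : nat} (p : R -> 'rV[R]_d) : Prop :=
  continuous p /\ forall t, p (t + 1) = p t.

Definition unit_speed {R : realType} {d : nat} (p : R -> 'rV[R]_d) : Prop :=
  {ae (@lebesgue_measure R),
    forall t, derivable p t 1 /\ enorm ('D_1 p t) = 1}.

Definition affine_on {R : realType} {d : nat} (s t : R) (p : R -> 'rV[R]_d) :
    Prop :=
  exists x v : 'rV[R]_d, forall u, s <= u <= t -> p u = x + u *: v.

(* The points a_1, ..., a_n of R/Z, indexed from 0 and with indices mod n, are
   lifted to R by a sequence with a_(i+n) = a_i + 1; an increasing lift exists
   exactly when the points are consecutive, in the positive direction (reversing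
   the order of the points changes neither the polygons nor their energy).  The
   arc between consecutive points is the image of [a_i, a_(i+1)]. *)
Definition subdivision {R : realType} {d : nat} (n : nat) (p : R -> 'rV[R]_d)
    (a : nat -> R) : Prop :=
  [/\ forall i, a i < a i.+1,
      forall i, a (i + n)%N = a i + 1,
      forall i, circle_dist (a i.+1) (a i) = n%:R^-1
    & forall i, affine_on (a i) (a i.+1) p].

(* That the length is 1 follows from [unit_speed]. *)
Definition equilateral_polygon {R : realType} (n d : nat) :
    set (R -> 'rV[R]_d) :=
  [set p | [/\ closed_curve p, unit_speed p & exists a, subdivision n p a]].

(* In the extended reals, [0^-1 = +oo]. *)
Definition mobius_energy_at {R : realType} {d : nat} (n : nat)
    (p : R -> 'rV[R]_d) (a : nat -> R) : \bar R :=
  (\sum_(i < n) \sum_(j < n | j != i)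
     (((enorm (p (a j) - p (a i)) ^+ 2)%:E)^-1
        - ((circle_dist (a j) (a i) ^+ 2)%:E)^-1)
     * (circle_dist (a i.+1) (a i))%:E * (circle_dist (a j.+1) (a j))%:E)%E.

(* The choice of the subdivision is immaterial, see [mobius_energyE] below. *)
Definition mobius_energy {R : realType} {d : nat} (n : nat)
    (p : R -> 'rV[R]_d) : \bar R :=
  mobius_energy_at n p (xget (fun=> 0) (subdivision n p)).

Definition is_minimizer {R : realType} {T : Type} (E : T -> \bar R)
    (P : set T) (p : T) : Prop :=
  P p /\ forall q, P q -> (E p <= E q)%E.

Definition eangle {R : realType} {d : nat} (x y z : 'rV[R]_d) : R :=
  acos (edot (x - y) (z - y) / (enorm (x - y) * enorm (z - y))).

Definition planar_det {R : realType} (x y : nat -> R) (i j k : nat) : R :=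
  (x j - x i) * (y k - y i) - (y j - y i) * (x k - x i).

(* [v] is an n-periodic sequence of points.  Each side leaves all the other
   vertices strictly on its left, for some orientation of some affine plane:
   this says that the polygon is the boundary of a convex polygon with n sides,
   traversed once with these consecutive vertices. *)
Definition convex_planar {R : realType} {d : nat} (n : nat)
    (v : nat -> 'rV[R]_d) : Prop :=
  exists c e f : 'rV[R]_d, exists x y : nat -> R,
    [/\ edot e e = 1, edot f f = 1, edot e f = 0,
        forall i, v i = c + x i *: e + y i *: f
      & forall i j, j != i %[mod n] -> j != i.+1 %[mod n] ->
          0 < planar_det x y i i.+1 j].

Definition regular_vertices {R : realType} {d : nat} (n : nat)
    (v : nat -> 'rV[R]_d) : Prop :=
  [/\ convex_planar n v,
      forall i j, enorm (v i.+1 - v i) = enorm (v j.+1 - v j)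
    & forall i j, eangle (v i) (v i.+1) (v i.+2)
                = eangle (v j) (v j.+1) (v j.+2)].

Definition regular_ngon {R : realType} (n d : nat) : set (R -> 'rV[R]_d) :=
  [set p | equilateral_polygon n p /\
     exists a, subdivision n p a /\ regular_vertices n (p \o a)].

Arguments equilateral_polygon {R} n d _.
Arguments regular_ngon {R} n d _.

Lemma circle_dist_le {R : realType} (s t : R) : circle_dist s t <= `|s - t|.
Proof.
apply: ge_inf; first by exists 0 => _ [k _ <-].
by exists 0 => //; rewrite addr0.
Qed.

Lemma circle_distDl {R : realType} (s t : R) :
  circle_dist (s + 1) t = circle_dist s t.
Proof.
rewrite /circle_dist; congr inf; apply/seteqP; split => _ [k _ <-].
  by exists (k + 1) => //; congr `|_|; rewrite intrD; ring.
by exists (k - 1) => //; congr `|_|; rewrite intrB; ring.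
Qed.

Lemma circle_distDr {R : realType} (s t : R) :
  circle_dist s (t + 1) = circle_dist s t.
Proof.
rewrite /circle_dist; congr inf; apply/seteqP; split => _ [k _ <-].
  by exists (k - 1) => //; congr `|_|; rewrite intrB; ring.
by exists (k + 1) => //; congr `|_|; rewrite intrD; ring.
Qed.

Lemma subdivision_step {R : realType} {d : nat} (n : nat) (p : R -> 'rV[R]_d)
    (a : nat -> R) :
  (0 < n)%N -> subdivision n p a -> forall i, a i = a 0%N + i%:R / n%:R.
Proof.
move=> n0 [ainc aper adist _].
have nR0 : (0 : R) < n%:R by rewrite ltr0n.
pose s i := a i.+1 - a i - n%:R^-1.
have s0 i : 0 <= s i.
  rewrite /s subr_ge0 -(adist i); apply: le_trans (circle_dist_le _ _) _.
  by rewrite ger0_norm // subr_ge0 ltW.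
have sE i m : \sum_(i <= k < i + m) s k = a (i + m)%N - a i - m%:R / n%:R.
  elim: m => [|m IH]; first by rewrite addn0 big_geq // mul0r; ring.
  rewrite addnS big_nat_recr ?leq_addr //= IH /s -natr1; field.
  by rewrite gt_eqF.
have step i : s i = 0.
  have := sE i n.
  have -> : a (i + n)%N - a i - n%:R / n%:R = 0.
    by rewrite aper divff ?gt_eqF //; ring.
  rewrite big_ltn; last by rewrite -[ltnLHS]addn0 ltn_add2l.
  move=> /eqP; rewrite paddr_eq0 //; last by apply: sumr_ge0.
  by case/andP => /eqP.
elim => [|i IH]; first by rewrite mul0r addr0.
have /eqP := step i; rewrite /s subr_eq0 => /eqP h.
by rewrite -(subrK (a i) (a i.+1)) h IH -natr1; field; rewrite gt_eqF.
Qed.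

Lemma affine_on_slope {R : realType} {d : nat} (p : R -> 'rV[R]_d) (s t : R) :
  affine_on s t p ->
  exists v, forall x y, s <= x <= t -> s <= y <= t -> p y - p x = (y - x) *: v.
Proof.
move=> [x0 [v h]]; exists v => x y hx hy.
by rewrite (h _ hx) (h _ hy) opprD addrACA subrr add0r scalerBl.
Qed.

Lemma affine_overlap {R : realType} {d : nat} (p : R -> 'rV[R]_d)
  (v w : 'rV[R]_d) (x y : R) :
  x < y -> p y - p x = (y - x) *: v -> p y - p x = (y - x) *: w -> v = w.
Proof.
move=> xy -> /eqP; rewrite -subr_eq0 -scalerBr scaler_eq0 subr_eq0 gt_eqF //=.
by rewrite subr_eq0 => /eqP.
Qed.

Lemma unit_speed_neq {R : realType} {d : nat} (p : R -> 'rV[R]_d) (s t : R) :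
  s < t -> unit_speed p ->
  ~ (forall x y, s <= x <= t -> s <= y <= t -> p y = p x).
Proof.
move=> st ph h.
have [A [mA A0 sA]] := ph.
have : (lebesgue_measure `]s, t[%classic <= lebesgue_measure A)%E.
  apply: le_measure; rewrite ?inE //.
  move=> x; rewrite /= in_itv /= => /andP[sx xt]; apply: sA => /= -[dp].
  suff -> : 'D_1 p x = 0.
    rewrite /enorm /edot big1 ?sqrtr0; last by move=> i _; rewrite mxE mul0r.
    by move/eqP; rewrite eq_sym oner_eq0.
  have hc : \forall z \near x, p z = cst (p x) z.
    near=> z; apply: h; rewrite ?(ltW sx) ?(ltW xt) //.
    apply/andP; split; apply/ltW; near: z; [exact: lt_nbhsr|exact: lt_nbhsl].
  by rewrite (near_eq_derive _ hc) derive_cst.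
rewrite [lebesgue_measure A]A0 lebesgue_measure_itv /= lte_fin st -EFinB.
by rewrite lee_fin subr_le0 leNgt st.
Unshelve. all: by end_near.
Qed.

Lemma subdivision_shift {R : realType} {d : nat} (n : nat)
    (p : R -> 'rV[R]_d) (a b : nat -> R) :
  (0 < n)%N -> closed_curve p -> unit_speed p ->
  subdivision n p a -> subdivision n p b ->
  exists m, (forall i, b i = a (m + i)%N) \/ (forall i, a i = b (m + i)%N).
Proof.
move=> n0 [_ pper] pus sa sb.
have aE := subdivision_step n0 sa; have bE := subdivision_step n0 sb.
have nR0 : (0 : R) < n%:R by rewrite ltr0n.
have nR0' : (n%:R : R) != 0 by rewrite gt_eqF.
pose x := n%:R * (b 0%N - a 0%N).
have bax : b 0%N = a 0%N + x / n%:R by rewrite /x; field.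
pose m := Num.floor x; pose r := x - m%:~R.
have r0 : 0 <= r by rewrite subr_ge0 floor_le.
have r1 : r < 1 by rewrite ltrBlDl -[X in _ + X]/(1%:~R) -intrD floorD1_gt.
have xE : x = m%:~R + r by rewrite /r addrC subrK.
have [rE|rN] := eqVneq r 0.
  exists `|m|%N; have [m0|m0] := leP 0 m; [left|right] => i.
    rewrite bE aE natrD bax xE rE natr_absz ger0_norm //; field.
    exact: nR0'.
  rewrite bE aE natrD bax xE rE natr_absz ltr0_norm // intrN; field.
  exact: nR0'.
have {rN}r0 : 0 < r by rewrite lt_neqAle eq_sym rN.
exfalso.
have [_ aper _ aaff] := sa; have [_ _ _ baff] := sb.
pose I := `|m|%N.
have bk i : exists k, b k = a (I + i)%N + r / n%:R.
  exists `|(I%:Z + i%:Z - m)%R|%N; rewrite bE aE bax xE.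
  rewrite natr_absz ger0_norm; last by rewrite /I; lia.
  rewrite natrD !intrD intrN -!pmulrn; field; exact: nR0'.
have dn (y z : R) : y < z -> y / n%:R < z / n%:R.
  by move=> yz; rewrite ltr_pM2r ?invr_gt0.
have eqv i v w :
    (forall x y, a (I + i)%N <= x <= a (I + i).+1 ->
      a (I + i)%N <= y <= a (I + i).+1 -> p y - p x = (y - x) *: v) ->
    (forall x y, a (I + i).+1 <= x <= a (I + i).+2 ->
      a (I + i).+1 <= y <= a (I + i).+2 -> p y - p x = (y - x) *: w) -> v = w.
  move=> hv hw; have [k kE] := bk i.
  have [u hu] := affine_on_slope (baff k).
  have k1E : b k.+1 = b k + 1 / n%:R.
    by rewrite !(bE _.+1) (bE k) -natr1 mulrDl addrA.
  have a1E : a (I + i).+1 = a (I + i)%N + 1 / n%:R.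
    by rewrite (aE _.+1) (aE (I + i)%N) -natr1 mulrDl addrA.
  have a2E : a (I + i).+2 = a (I + i)%N + 1 / n%:R + 1 / n%:R.
    by rewrite -a1E (aE _.+2) (aE _.+1) -(natr1 _.+1) mulrDl addrA.
  have t0 := dn _ _ r0; have t1 := dn _ _ r1; rewrite mul0r in t0.
  transitivity u.
    apply: (@affine_overlap _ _ p _ _ (b k) (a (I + i).+1)).
    - lra.
    - by apply: hv; apply/andP; split; lra.
    - by apply: hu; apply/andP; split; lra.
  apply: (@affine_overlap _ _ p _ _ (a (I + i).+1) (b k.+1)).
  - lra.
  - by apply: hu; apply/andP; split; lra.
  - by apply: hw; apply/andP; split; lra.
have [v hv] := affine_on_slope (aaff (I + 0)%N).
have hall i : forall x y, a (I + i)%N <= x <= a (I + i).+1 ->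
      a (I + i)%N <= y <= a (I + i).+1 -> p y - p x = (y - x) *: v.
  elim: i => [//|i IH].
  have [w hw] := affine_on_slope (aaff (I + i.+1)%N).
  by rewrite addnS in hw *; rewrite (eqv i v w IH hw).
have alt i : a i < a i.+1 by case: sa.
have tot k : p (a (I + k)%N) - p (a I) = (a (I + k)%N - a I) *: v.
  elim: k => [|k IH]; first by rewrite addn0 !subrr scale0r.
  rewrite -(subrK (p (a (I + k)%N)) (p (a (I + k.+1)%N))) -addrA IH.
  rewrite (hall k); first by rewrite -scalerDl addrA addnS subrK.
  - by rewrite lexx ltW.
  - by rewrite addnS lexx andbT ltW.
have := tot n; rewrite aper pper subrr addrAC subrr add0r scale1r => v0.
apply: (unit_speed_neq (alt I) pus) => y z yI zI.
have := hv y z; rewrite addn0 => /(_ yI zI); rewrite -v0 scaler0 => /eqP.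
by rewrite subr_eq0 => /eqP.
Qed.

Lemma sum_shift (T : nmodType) (n : nat) (F : nat -> T) :
  (0 < n)%N -> (forall i, F (i + n)%N = F i) ->
  \sum_(i < n) F i.+1 = \sum_(i < n) F i.
Proof.
case: n => // n _ h; rewrite big_ord_recr big_ord_recl /= addrC; congr (_ + _).
by rewrite -(h 0%N) add0n.
Qed.

Lemma mobius_energy_at_shift {R : realType} {d : nat} (n : nat)
    (p : R -> 'rV[R]_d) (a : nat -> R) (m : nat) :
  (0 < n)%N -> closed_curve p -> subdivision n p a ->
  mobius_energy_at n p (fun i => a (m + i)%N) = mobius_energy_at n p a.
Proof.
move=> n0 [_ pper] [_ aper _ _].
pose G i j : \bar R := ((((enorm (p (a j) - p (a i)) ^+ 2)%:E)^-1
        - ((circle_dist (a j) (a i) ^+ 2)%:E)^-1)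
     * (circle_dist (a i.+1) (a i))%:E * (circle_dist (a j.+1) (a j))%:E)%E.
pose H i j : \bar R := if j == i %[mod n] then 0%E else G i j.
have HE k : mobius_energy_at n p (fun i => a (k + i)%N)
          = (\sum_(i < n) \sum_(j < n) H (k + i)%N (k + j)%N)%E.
  apply: eq_bigr => i _; rewrite big_mkcond; apply: eq_bigr => j _.
  rewrite /H eqn_modDl !modn_small // -[RHS]if_neg; case: ifP => //.
  by rewrite /G !addnS.
have Hi i j : H (i + n)%N j = H i j.
  by rewrite /H /G modnDr -addSn !aper pper !circle_distDr circle_distDl.
have Hj i j : H i (j + n)%N = H i j.
  by rewrite /H /G modnDr -addSn !aper pper ?circle_distDr !circle_distDl.
transitivity (mobius_energy_at n p (fun i => a (0 + i)%N)); last by [].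
elim: m => // m <-; rewrite !HE.
rewrite -(sum_shift (F := fun i => \sum_(j < n) H (m + i)%N (m + j)%N)%E n0).
  apply: eq_bigr => i _.
  rewrite -(sum_shift (F := fun j => H (m + i.+1)%N (m + j)%N) n0).
    by apply: eq_bigr => j _; rewrite !addnS.
  by move=> j; rewrite addnA Hj.
by move=> i; apply: eq_bigr => j _; rewrite addnA Hi.
Qed.

Lemma mobius_energyE {R : realType} {d : nat} (n : nat) (p : R -> 'rV[R]_d)
    (a : nat -> R) :
  (0 < n)%N -> equilateral_polygon n d p -> subdivision n p a ->
  mobius_energy n p = mobius_energy_at n p a.
Proof.
move=> n0 [pc pus _] sa; rewrite /mobius_energy.
have sb := xgetPex (fun=> 0) (ex_intro _ a sa : exists b, subdivision n p b).
set b := xget _ _ in sb *.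
have [m [h|h]] := subdivision_shift n0 pc pus sa sb.
  rewrite -(mobius_energy_at_shift m n0 pc sa); congr mobius_energy_at.
  exact/funext.
rewrite -(mobius_energy_at_shift m n0 pc sb); congr mobius_energy_at.
by apply/esym/funext.
Qed.

(* Main.v *)
(* Let S_k be the sum of the squared lengths of the chords joining vertices k
   apart. In the quadrilateral v_i, v_(i+1), v_(i+k), v_(i+k+1) the squares of the
   diagonals exceed those of the two unit-step sides by twice an inner product;
   summing over i and weighting AM-GM by the values for the regular polygon gives a
   linear inequality between S_(k-1), S_k, S_(k+1) and S_1, and a maximum principle
   then bounds S_k by its value for the regular polygon, without Fourier analysis.
   Convexity of 1/x turns these bounds into the bound for the energy. In the
   equality case all chords have the lengths of the regular polygon, which turns
   the inner product inequality into a third order linear recurrence for the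
   vertices, whose solution is explicit. Conversely, for regular vertices the edges
   are obtained by iterating a rotation, and convexity forces its angle to be
   2 pi / n. *)
Require Import Defs.
From mathcomp Require Import all_boot all_order all_algebra.
From mathcomp Require Import all_classical all_reals all_analysis.
From mathcomp Require Import ring lra zify.

Set Implicit Arguments.
Unset Strict Implicit.
Unset Printing Implicit Defensive.

Import Order.TTheory GRing.Theory Num.Theory.
Import numFieldNormedType.Exports.

Local Open Scope classical_set_scope.
Local Open Scope ring_scope.

(** * Euclidean inner product and squared distances *)

Section EuclideanDot.
Context {R : realType} {d : nat}.
Implicit Types (u v w : 'rV[R]_d) (k : R).

Lemma edotC u v : edot u v = edot v u.
Proof. by apply: eq_bigr => i _; rewrite mulrC. Qed.

Lemma edotDl u v w : edot (u + v) w = edot u w + edot v w.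
Proof. by rewrite -big_split; apply: eq_bigr => i _; rewrite mxE mulrDl. Qed.

Lemma edotZl k u v : edot (k *: u) v = k * edot u v.
Proof. by rewrite /edot mulr_sumr; apply: eq_bigr => i _; rewrite mxE mulrA. Qed.

Lemma edotNl u v : edot (- u) v = - edot u v.
Proof. by rewrite -scaleN1r edotZl mulN1r. Qed.

Lemma edotDr u v w : edot u (v + w) = edot u v + edot u w.
Proof. by rewrite edotC edotDl !(edotC _ u). Qed.

Lemma edotZr k u v : edot u (k *: v) = k * edot u v.
Proof. by rewrite edotC edotZl edotC. Qed.

Lemma edotNr u v : edot u (- v) = - edot u v.
Proof. by rewrite edotC edotNl edotC. Qed.

Definition edotE := (edotDl, edotDr, edotNl, edotNr, edotZl, edotZr).

Lemma edot_ge0 u : 0 <= edot u u.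
Proof. by apply: sumr_ge0 => i _; rewrite -expr2 sqr_ge0. Qed.

Lemma edot_eq0 u : edot u u = 0 -> u = 0.
Proof.
move=> /eqP; rewrite psumr_eq0 => [/allP h|i _]; last by rewrite -expr2 sqr_ge0.
apply/rowP => i; have /implyP/(_ isT) := h i (mem_index_enum i).
by rewrite mulf_eq0 orbb mxE => /eqP.
Qed.

Lemma enorm_sqr u : enorm u ^+ 2 = edot u u.
Proof. by rewrite sqr_sqrtr ?edot_ge0. Qed.

Lemma enorm_ge0 u : 0 <= enorm u. Proof. exact: sqrtr_ge0. Qed.

Lemma enormZ k u : 0 <= k -> enorm (k *: u) = k * enorm u.
Proof.
by move=> k0; rewrite /enorm !edotE mulrA -expr2 sqrtrM ?sqr_ge0 // sqrtr_sqr ger0_norm.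
Qed.

Definition sqdist u v := edot (v - u) (v - u).

Lemma sqdist_ge0 u v : 0 <= sqdist u v. Proof. exact: edot_ge0. Qed.

Lemma sqdistC u v : sqdist u v = sqdist v u.
Proof. by rewrite /sqdist -[v - u]opprB edotNl edotNr opprK. Qed.

Lemma sqdistxx u : sqdist u u = 0.
Proof. by rewrite /sqdist subrr -(scale0r 0) edotZl mul0r. Qed.

(** Of the sides of the quadrilateral [a b c e], one opposite pair enters by its lengths, and the
    pair [a e], [b c] only through an inner product, to which AM-GM applies. *)
Lemma quadrilateral_sqdist (a b c e : 'rV[R]_d) :
  sqdist a c + sqdist b e =
  sqdist a b + sqdist c e + 2 * edot (e - a) (c - b).
Proof.
rewrite /sqdist !edotE ?(edotC b a) ?(edotC c a) ?(edotC e a) ?(edotC c b).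
rewrite ?(edotC e b) ?(edotC e c).
ring.
Qed.

Lemma edot_subZ k u w :
  edot (u - k *: w) (u - k *: w) =
  edot u u - 2 * k * edot u w + k ^+ 2 * edot w w.
Proof. by rewrite !edotE (edotC w u); ring. Qed.

Lemma edotB u w : edot (u - w) (u - w) = edot u u - 2 * edot u w + edot w w.
Proof. by rewrite -[w]scale1r edot_subZ !scale1r; ring. Qed.

(** Expands the square of [k *: u - k' *: v]. Weights of either sign later give both halves of
    Cauchy-Schwarz. *)
Lemma edot_amgm k k' u v :
  2 * k * k' * edot u v <= k ^+ 2 * edot u u + k' ^+ 2 * edot v v.
Proof.
have := edot_ge0 (k *: u - k' *: v).
rewrite !edotE (edotC v u); lra.
Qed.

End EuclideanDot.

Lemma sum_periodic_shift (T : nmodType) (n : nat) (F : nat -> T) (k : nat) :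
  (0 < n)%N -> (forall i, F (i + n)%N = F i) ->
  \sum_(i < n) F (i + k)%N = \sum_(i < n) F i.
Proof.
move=> n0 Fn; elim: k => [|k IH]; first by apply: eq_bigr => i _; rewrite addn0.
rewrite -IH -(sum_shift (F := fun i => F (i + k)%N)) //.
  by apply: eq_bigr => i _; rewrite addSnnS.
by move=> i; rewrite addnAC Fn.
Qed.

(** * Sines of multiples of [pi / n] *)

Section Trigonometry.
Context {R : realType}.
Implicit Types x y : R.

(** By this identity the regular polygon gives equality in [chord_sum_rec] for suitable weights. *)
Lemma sinDsinB x y : sin (x + y) * sin (x - y) = sin x ^+ 2 - sin y ^+ 2.
Proof.
rewrite sinD sinB.
have hx := cos2Dsin2 x; have hy := cos2Dsin2 y.
transitivity ((sin x * cos y) ^+ 2 - (cos x * sin y) ^+ 2); first by ring.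
rewrite !exprMn (_ : cos y ^+ 2 = 1 - sin y ^+ 2); last by lra.
rewrite (_ : cos x ^+ 2 = 1 - sin x ^+ 2); last by lra.
ring.
Qed.

Lemma sin_angle_gt0 (n k : nat) :
  (0 < k < n)%N -> 0 < sin (k%:R * (pi / n%:R)) :> R.
Proof.
move=> /andP[k0 kn]; have n0 : (0 : R) < n%:R by rewrite ltr0n (ltn_trans k0).
apply: sin_gt0_pi; have p0 := pi_gt0 R; apply/andP; split.
  by rewrite mulr_gt0 ?ltr0n // divr_gt0.
by rewrite mulrCA gtr_pMr // ltr_pdivrMr // mul1r ltr_nat.
Qed.

End Trigonometry.

(** * Sums of the squared chords of a given span *)

Section ChordSums.
Context {R : realType} {d : nat}.
Variables (n : nat) (v : nat -> 'rV[R]_d).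
Hypothesis n0 : (0 < n)%N.
Hypothesis vn : forall i, v (i + n)%N = v i.

Definition chord_sum (k : nat) : R := \sum_(i < n) sqdist (v i) (v (i + k)%N).

Lemma chord_sum_shift (k m : nat) :
  \sum_(i < n) sqdist (v (i + m)%N) (v (i + m + k)%N) = chord_sum k.
Proof.
rewrite (sum_periodic_shift (F := fun i => sqdist (v i) (v (i + k)%N))) //.
by move=> i; rewrite addnAC !vn.
Qed.

(** A chord spanning [n - 1] steps is a side run backwards. *)
Lemma chord_sum_symm : chord_sum n.-1 = chord_sum 1.
Proof.
rewrite -(chord_sum_shift n.-1 1); apply: eq_bigr => i _.
by rewrite -addnA add1n prednK // vn sqdistC.
Qed.

(** The quadrilateral on [v i], [v i.+1], [v (i + k.+1)], [v (i + k.+2)] has diagonals of span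
    [k.+1]. Summing over [i] expresses the left side by inner products of chords of spans [k.+2] and
    [k], and AM-GM bounds each of them. *)
Lemma chord_sum_rec (x y : R) (k : nat) :
  2 * x * y * (chord_sum k.+1 - chord_sum 1) <=
  x ^+ 2 * chord_sum k.+2 + y ^+ 2 * chord_sum k.
Proof.
have e : 2 * chord_sum k.+1 = 2 * chord_sum 1 +
    2 * \sum_(i < n) edot (v (i + k.+2)%N - v i) (v (i + k.+1)%N - v i.+1).
  transitivity (chord_sum k.+1 +
      \sum_(i < n) sqdist (v (i + 1)%N) (v (i + 1 + k.+1)%N)).
    by rewrite chord_sum_shift; ring.
  transitivity (chord_sum 1 +
      \sum_(i < n) sqdist (v (i + k.+1)%N) (v (i + k.+1 + 1)%N) +
    2 * \sum_(i < n) edot (v (i + k.+2)%N - v i) (v (i + k.+1)%N - v i.+1)).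
    rewrite mulr_sumr -!big_split; apply: eq_bigr => i _ /=.
    rewrite quadrilateral_sqdist -(addnA i 1) add1n -(addnA i k.+1) !addn1.
    by [].
  by rewrite chord_sum_shift; ring.
have -> : chord_sum k.+1 - chord_sum 1 =
  \sum_(i < n) edot (v (i + k.+2)%N - v i) (v (i + k.+1)%N - v i.+1) by lra.
rewrite -(chord_sum_shift k 1) !mulr_sumr -big_split; apply: ler_sum => i _.
apply: le_trans (edot_amgm _ _ _ _) _.
by rewrite addn1 addSnnS /sqdist lexx.
Qed.

(* Maximum principle: the ratio [chord_sum k / sin (k pi / n) ^+ 2] cannot have
   an interior maximum larger than its value at [k = 1], because the regular
   polygon satisfies [chord_sum_rec] with equality. *)
Lemma chord_sum_le (k : nat) : (0 < k < n)%N ->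
  chord_sum k * sin (pi / n%:R) ^+ 2 <=
  sin (k%:R * (pi / n%:R)) ^+ 2 * chord_sum 1.
Proof.
set al : R := pi / n%:R; move=> kn.
have n1 : (1 < n)%N by lia.
pose s k : R := sin (k%:R * al).
have sp j : (0 < j < n)%N -> 0 < s j by exact: sin_angle_gt0.
pose Q k : R := chord_sum k / s k ^+ 2.
have QE j : (0 < j < n)%N -> chord_sum j = Q j * s j ^+ 2.
  by move=> /sp sj; rewrite divfK // expf_neq0 // gt_eqF.
(* Span 0 is left out of the maximum, since [s 0] vanishes. *)
have [m [m0 mmax]] : exists m : 'I_n, (0 < m)%N /\
    forall j : 'I_n, (0 < j)%N -> Q j <= Q m.
  pose P := fun i : 'I_n => (0 < i)%N.
  have P1 : P (Ordinal n1) by [].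
  by case: (Order.TotalTheory.arg_maxP (fun i : 'I_n => Q i) P1) => m m0 h; exists m.
have Qm : Q m <= Q 1%N.
  have [/eqP m1|m1] := boolP (m == 1%N :> nat); first by rewrite m1.
  have [/eqP m1'|m1'] := boolP (m == n.-1 :> nat).
    rewrite m1' /Q chord_sum_symm (_ : s n.-1 = s 1%N) //.
    have nR : (n%:R : R) != 0 by rewrite pnatr_eq0; lia.
    rewrite /s -subn1 natrB // (_ : _ * al = - (1 * al) + pi); last first.
      by rewrite /al; field.
    by rewrite sinDpi sinN opprK.
  have [j mj] : exists j, m = j.+2 :> nat by exists (m - 2)%N; lia.
  have mn := ltn_ord m.
  have hA : (0 < j.+1 < n)%N by lia.
  have hB : (0 < j.+3 < n)%N by lia.
  (* The weights are crossed: each neighbouring chord sum is weighted by the sine of the other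
     neighbour, so that by maximality both terms are at most [Q m * (s j.+1 * s j.+3) ^+ 2]. *)
  have := chord_sum_rec (s j.+1) (s j.+3) j.+1.
  have QA := mmax (Ordinal (proj2 (andP hA))) isT.
  have QB := mmax (Ordinal (proj2 (andP hB))) isT.
  rewrite mj /= in QA QB *.
  rewrite (QE _ hA) (QE _ hB) (QE j.+2); last by lia.
  rewrite (QE 1%N); last by lia.
  move=> H.
  have sA := sp _ hA; have sB := sp _ hB.
  have e : s j.+1 * s j.+3 = s j.+2 ^+ 2 - s 1%N ^+ 2.
    rewrite /s -sinDsinB mulrC -mulrDl -mulrBl.
    by congr (sin (_ * _) * sin (_ * _)); rewrite -?natrD -?natrB ?addn1 ?subn1.
  have s1 : 0 < s 1%N ^+ 2 by rewrite exprn_gt0 // sp.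
  have hAB : 0 < s j.+1 * s j.+3 by rewrite mulr_gt0.
  have h1 : s j.+1 ^+ 2 * (Q j.+3 * s j.+3 ^+ 2) <= Q j.+2 * (s j.+1 * s j.+3) ^+ 2.
    rewrite (_ : _ * (_ * _) = Q j.+3 * (s j.+1 * s j.+3) ^+ 2); last by ring.
    by rewrite ler_pM2r // exprn_gt0.
  have h2 : s j.+3 ^+ 2 * (Q j.+1 * s j.+1 ^+ 2) <= Q j.+2 * (s j.+1 * s j.+3) ^+ 2.
    rewrite (_ : _ * (_ * _) = Q j.+1 * (s j.+1 * s j.+3) ^+ 2); last by ring.
    by rewrite ler_pM2r // exprn_gt0.
  have h3 : 2 * (s j.+1 * s j.+3) * (Q j.+2 * s j.+2 ^+ 2 - Q 1%N * s 1%N ^+ 2) <=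
            2 * (s j.+1 * s j.+3) * (Q j.+2 * (s j.+1 * s j.+3)) by lra.
  (* With [m = j.+2], cancelling the common factor and using [e] leaves [Q m * s m ^+ 2 - Q 1 * s 1
     ^+ 2 <= Q m * (s m ^+ 2 - s 1 ^+ 2)], where the terms in [s m] cancel. *)
  rewrite ler_pM2l in h3; last by lra.
  rewrite -(ler_pM2r s1); move: h3; rewrite e; lra.
have := mmax (Ordinal (proj2 (andP kn))) (proj1 (andP kn)) => /= Qk.
rewrite (QE _ kn) (QE 1%N); last by lia.
rewrite -[X in sin X ^+ 2]mul1r -/(s 1%N) -/(s k).
rewrite [leRHS]mulrCA -mulrA ler_wpM2r ?(le_trans Qk) //.
by rewrite mulr_ge0 ?sqr_ge0.
Qed.

End ChordSums.

(** * Chord lengths of the regular polygon *)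

(** The squared chord across [t] steps in a regular [n]-gon of side [1 / n], whose circumradius is
    [1 / (2 n sin (pi / n))]. A real argument allows index differences of either sign. *)
Definition regular_sqchord {R : realType} (n : nat) (t : R) : R :=
  (sin (t * (pi / n%:R)) / (n%:R * sin (pi / n%:R))) ^+ 2.

Section RegularChord.
Context {R : realType}.
Implicit Types t : R.

Lemma regular_sqchordN n t : regular_sqchord n (- t) = regular_sqchord n t.
Proof. by rewrite /regular_sqchord mulNr sinN mulNr sqrrN. Qed.

Lemma regular_sqchord_distC n t t' :
  regular_sqchord n (t - t') = regular_sqchord n (t' - t).
Proof. by rewrite -opprB regular_sqchordN. Qed.

Lemma regular_sqchordDn n t : (0 < n)%N ->
  regular_sqchord n (t + n%:R) = regular_sqchord n t.
Proof.
move=> n0; rewrite /regular_sqchord mulrDl [n%:R * _]mulrC.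
by rewrite divfK ?pnatr_eq0 -?lt0n // sinDpi mulNr sqrrN.
Qed.

Lemma regular_sqchord_gt0 n (k : nat) : (0 < k < n)%N ->
  0 < regular_sqchord n (k%:R : R).
Proof.
move=> kn; rewrite exprn_gt0 // divr_gt0 ?sin_angle_gt0 //.
rewrite mulr_gt0 ?ltr0n; [by []|lia|].
by rewrite -[pi / _]mul1r (@sin_angle_gt0 _ n 1) //; lia.
Qed.

Lemma regular_sqchord_ord_gt0 n (i j : 'I_n) : j != i ->
  0 < regular_sqchord n ((j%:R : R) - i%:R).
Proof.
move=> ji; have [ij|] := ltnP i j.
  by rewrite -natrB ?regular_sqchord_gt0 //; have := ltn_ord j; lia.
rewrite leq_eqVlt val_eqE (negPf ji) /= => {}ji; rewrite regular_sqchord_distC.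
by rewrite -natrB ?regular_sqchord_gt0 //; [have := ltn_ord i; lia|exact: ltnW].
Qed.

Lemma regular_sqchord1 n : (1 < n)%N -> regular_sqchord n (1 : R) = n%:R ^- 2.
Proof.
move=> n1; have s0 : 0 < sin (pi / n%:R) :> R.
  by rewrite -[pi / _]mul1r (@sin_angle_gt0 _ n 1).
rewrite /regular_sqchord mul1r invfM mulrCA divff ?gt_eqF // mulr1.
by rewrite exprVn.
Qed.

End RegularChord.

(** The pivot of the proof: for equilateral polygons it is equivalent both to minimality and to
    [regular_vertices]. *)
Definition chords_regular {R : realType} {d : nat} (n : nat)
    (v : nat -> 'rV[R]_d) :=
  forall i j : nat, sqdist (v i) (v j) = regular_sqchord n (j%:R - i%:R).

(** Both sides are [n]-periodic in each index and vanish when the indices agree mod [n]. *)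
Lemma chords_regularP {R : realType} {d : nat} (n : nat) (v : nat -> 'rV[R]_d) :
  (0 < n)%N -> (forall i, v (i + n)%N = v i) ->
  (forall i j : 'I_n, j != i ->
     sqdist (v i) (v j) = regular_sqchord n (j%:R - i%:R)) ->
  chords_regular n v.
Proof.
move=> n0 vn h.
have vm i : v i = v (i %% n)%N.
  rewrite {1}(divn_eq i n); elim: (i %/ n)%N => [|m IH]; first by rewrite add0n.
  by rewrite mulSnr addnAC vn.
have cm i (t : R) : regular_sqchord n (i%:R + t) = regular_sqchord n ((i %% n)%:R + t).
  rewrite {1}(divn_eq i n); elim: (i %/ n)%N => [|m IH]; first by rewrite add0n.
  by rewrite mulSnr addnAC natrD addrAC regular_sqchordDn.
move=> i j; rewrite (vm i) (vm j) cm regular_sqchord_distC cm.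
rewrite regular_sqchord_distC.
have [ij|ij] := eqVneq (j %% n)%N (i %% n)%N.
  by rewrite ij sqdistxx subrr /regular_sqchord mul0r sin0 mul0r expr0n.
exact: (h (Ordinal (ltn_pmod i n0)) (Ordinal (ltn_pmod j n0))).
Qed.

(** * Comparison of the chord sums with those of the regular polygon *)

Section EnergyDefect.
Context {R : realType} {d : nat}.
Variables (n : nat) (v : nat -> 'rV[R]_d).
Hypothesis n1 : (1 < n)%N.
Hypothesis vn : forall i, v (i + n)%N = v i.
Hypothesis side : forall i, sqdist (v i) (v i.+1) = n%:R ^- 2.

Let n0 : (0 < n)%N := ltnW n1.

Let chord i j : R := sqdist (v i) (v j).
Let rchord (i j : nat) : R := regular_sqchord n (j%:R - i%:R).

(** Sides [1 / n] give the sum of span 1 the value [1 / n], which turns the homogeneous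
    [chord_sum_le] into an absolute bound. *)
Lemma chord_sum_le_regular (k : nat) : (0 < k < n)%N ->
  chord_sum n v k <= n%:R * regular_sqchord n k%:R.
Proof.
move=> kn; have s0 : 0 < sin (pi / n%:R) :> R.
  by rewrite -[pi / _]mul1r (@sin_angle_gt0 _ n 1).
have nR : (0 : R) < n%:R by rewrite ltr0n.
have := chord_sum_le n0 vn kn.
have -> : chord_sum n v 1 = n%:R^-1.
  rewrite /chord_sum (eq_bigr (fun=> n%:R ^- 2)) => [|i _]; last by rewrite addn1.
  rewrite sumr_const card_ord -mulr_natl; field; exact: lt0r_neq0.
rewrite -ler_pdivlMr ?exprn_gt0 // => h; apply: le_trans h _.
rewrite /regular_sqchord le_eqVlt; apply/orP; left; apply/eqP; field.
by rewrite !gt_eqF.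
Qed.

(** This is the first-order term of the tangent line bound on the inverse. For a fixed span the
    denominator is constant, so that the sum over [i] reduces to [chord_sum_le_regular]. *)
Lemma regular_defect_ge0 :
  0 <= \sum_(i < n) \sum_(j < n | j != i) (rchord i j - chord i j) / rchord i j ^+ 2.
Proof.
(* Extended by zero to the diagonal, the summand is periodic in [j], which permits the change of
   index [j = i + k]. *)
pose F (i j : nat) := if j == i %[mod n] then 0 else
  (rchord i j - chord i j) / rchord i j ^+ 2.
have Fj i j : F i (j + n)%N = F i j.
  rewrite /F modnDr; case: ifP => // _; rewrite /rchord /chord vn natrD addrAC.
  by rewrite regular_sqchordDn.
have Fi i j : F (i + n)%N j = F i j.
  rewrite /F modnDr; case: ifP => // _; rewrite /rchord /chord vn.
  rewrite regular_sqchord_distC natrD addrAC regular_sqchordDn //.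
  by rewrite regular_sqchord_distC.
have -> : \sum_(i < n) \sum_(j < n | j != i)
    (rchord i j - chord i j) / rchord i j ^+ 2 = \sum_(i < n) \sum_(k < n) F i (i + k)%N.
  apply: eq_bigr => i _.
  transitivity (\sum_(j < n) F i j).
    rewrite big_mkcond; apply: eq_bigr => j _.
    by rewrite /F !modn_small // -[RHS]if_neg.
  rewrite -(sum_periodic_shift (F := F i) i n0) //.
  by apply: eq_bigr => k _; rewrite addnC.
rewrite exchange_big sumr_ge0 // => k _.
have [k0|k0] := eqVneq (k : nat) 0%N.
  by rewrite big1 // => i _; rewrite /F k0 addn0 eqxx.
have kn : (0 < k < n)%N by have := ltn_ord k; lia.
have c0 := regular_sqchord_gt0 (R := R) kn.
have -> : \sum_(i < n) F i (i + k)%N =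
   (n%:R * regular_sqchord n k%:R - chord_sum n v k) / regular_sqchord n k%:R ^+ 2.
  rewrite -[n%:R * _](_ : \sum_(i < n) regular_sqchord n k%:R = _); last first.
    by rewrite sumr_const card_ord mulr_natl.
  rewrite /chord_sum -sumrB mulr_suml; apply: eq_bigr => i _.
  rewrite /F -[X in _ == X %[mod n]]addn0 eqn_modDl !modn_small // (negPf k0).
  by rewrite /rchord /chord natrD [_ + k%:R]addrC addrK.
by rewrite divr_ge0 ?sqr_ge0 // subr_ge0 chord_sum_le_regular.
Qed.

End EnergyDefect.

(** * The metric of the circle at the points of a subdivision *)

Section CircleDist.
Context {R : realType}.
Implicit Types s t c : R.

Lemma circle_distDD s t c : circle_dist (c + s) (c + t) = circle_dist s t.
Proof.
rewrite /circle_dist; congr inf; apply/seteqP; split => _ [k _ <-];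
  by exists k => //; congr `|_|; ring.
Qed.

(** Each representative of the difference is an integer over [n], and the integer is nonzero because
    [i] and [j] are distinct residues. *)
Lemma circle_dist_gt0 (n : nat) (i j : 'I_n) : j != i ->
  0 < circle_dist (j%:R / n%:R : R) (i%:R / n%:R).
Proof.
move=> ji; have n0 : (0 : R) < n%:R by rewrite ltr0n; case: n i {ji} j => [[]|].
apply: (@lt_le_trans _ _ n%:R^-1); first by rewrite invr_gt0.
apply: lb_le_inf; first by exists `|j%:R / n%:R - i%:R / n%:R + 0%:~R|, 0.
move=> _ [k _ <-].
have -> : j%:R / n%:R - i%:R / n%:R + k%:~R = (j%:Z - i%:Z + k * n%:Z)%:~R / n%:R :> R.
  by rewrite !intrD intrN intrM -!pmulrn; field; rewrite gt_eqF.
rewrite normrM [`|n%:R^-1|]gtr0_norm ?invr_gt0 //.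
apply: ler_peMl; first by rewrite invr_ge0 ltW.
rewrite -intr_norm ler1z -gtz0_ge1 normr_gt0.
apply: contraNneq ji => e; apply/eqP/val_inj => /=.
have := ltn_ord i; have := ltn_ord j.
have : k = 0 \/ 1 <= k \/ k <= -1 by lia.
by case=> [k0|[k0|k0]]; nia.
Qed.

Lemma circle_dist_subdivision {d : nat} (n : nat) (p : R -> 'rV[R]_d) (a : nat -> R) i j :
  (0 < n)%N -> subdivision n p a ->
  circle_dist (a i) (a j) = circle_dist (i%:R / n%:R) (j%:R / n%:R).
Proof.
by move=> n0 sa; rewrite (subdivision_step n0 sa i) (subdivision_step n0 sa j)
  circle_distDD.
Qed.

(** For [n >= 2] the integer [1 + k * n] never vanishes, so no translate of [1 / n] is closer to the
    origin. *)
Lemma circle_dist_step (n : nat) : (2 <= n)%N ->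
  circle_dist (n%:R^-1 : R) 0 = n%:R^-1.
Proof.
move=> n2; have n0 : (0 : R) < n%:R by rewrite ltr0n; lia.
apply/eqP; rewrite eq_le; apply/andP; split.
  apply: le_trans (circle_dist_le _ _) _.
  by rewrite subr0 gtr0_norm ?invr_gt0.
apply: lb_le_inf; first by exists `|n%:R^-1 - 0 + 0%:~R|, 0.
move=> _ [k _ <-].
have -> : n%:R^-1 - 0 + k%:~R = (1 + k * n%:Z)%:~R / n%:R :> R.
  by rewrite intrD intrM -!pmulrn; field; rewrite gt_eqF.
rewrite normrM [`|n%:R^-1|]gtr0_norm ?invr_gt0 //.
apply: ler_peMl; first by rewrite invr_ge0 ltW.
rewrite -intr_norm ler1z -gtz0_ge1 normr_gt0.
apply/eqP => e; have : (n%:Z %| 1)%Z by apply/dvdzP; exists (- k); rewrite mulNr; lra.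
by rewrite dvdz1 absz_nat => /eqP nE; rewrite nE in n2.
Qed.

End CircleDist.

(** * Lower bound for the energy and its equality case *)

Definition regular_energy {R : realType} (n : nat) : R :=
  \sum_(i < n) \sum_(j < n | j != i)
    ((regular_sqchord n (j%:R - i%:R))^-1
     - (circle_dist (j%:R / n%:R) (i%:R / n%:R) ^+ 2)^-1) / n%:R / n%:R.

(** Tangent line of the convex [1 / x] at [m], with a quadratic remainder kept for the equality
    case. The exact remainder has [x] where this one has [x + m], whose positivity survives at
    [x = 0]. *)
Lemma inve_ge {R : realType} (x m : R) : 0 <= x -> 0 < m ->
  ((m^-1 + (m - x) / m ^+ 2 + (x - m) ^+ 2 / ((x + m) * m ^+ 2))%:E <= (x%:E)^-1)%E.
Proof.
move=> x0 m0; rewrite inver; case: eqVneq => [_|xN]; first exact: leey.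
have {x0 xN}x0 : 0 < x by rewrite lt_neqAle eq_sym xN.
rewrite lee_fin -subr_ge0.
have -> : x^-1 - (m^-1 + (m - x) / m ^+ 2 + (x - m) ^+ 2 / ((x + m) * m ^+ 2)) =
  (x - m) ^+ 2 / (x * m * (x + m)).
  by field; rewrite !gt_eqF ?addr_gt0.
by rewrite divr_ge0 ?sqr_ge0 // !mulr_ge0 ?addr_ge0 ?ltW.
Qed.

Lemma is_derive_line {R : realType} {d : nat} (x0 w : 'rV[R]_d) (x : R) :
  is_derive x 1 (fun u : R => x0 + u *: w) w.
Proof.
have h : is_derive x 1 (fun u : R => u *: w) w.
  apply: DeriveDef; first exact: diff_derivable.
  by rewrite deriveE // diff_val scale1r.
rewrite -[X in is_derive _ _ _ X]add0r; exact: is_deriveD.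
Qed.

Section PolygonEnergy.
Context {R : realType} {d : nat}.
Variables (n : nat) (p : R -> 'rV[R]_d) (a : nat -> R).
Hypothesis n1 : (1 < n)%N.
Hypothesis pP : equilateral_polygon n d p.
Hypothesis sa : subdivision n p a.

Let n0 : (0 < n)%N := ltnW n1.
Let v := p \o a.

Lemma vertices_periodic i : v (i + n)%N = v i.
Proof. by case: pP sa => [[_ pper] _ _] [_ aper _ _]; rewrite /v /= aper pper. Qed.

(** The velocity is constant on each arc, and it is a unit vector: otherwise the open arc, of
    positive measure, would lie in the exceptional null set. *)
Lemma sqdist_side i : sqdist (v i) (v i.+1) = n%:R ^- 2.
Proof.
have nR : (0 : R) < n%:R by rewrite ltr0n.
have [_ pus _] := pP; have [ainc _ _ aff] := sa.
have [x0 [w hw]] := aff i.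
have aS : a i.+1 = a i + n%:R^-1.
  rewrite (subdivision_step n0 sa i.+1) (subdivision_step n0 sa i) -natr1.
  by field; exact: lt0r_neq0.
have w1 : edot w w = 1.
  have [A [mA A0 sA]] := pus.
  apply: contrapT => wN.
  have : (lebesgue_measure `]a i, a i.+1[%classic <= lebesgue_measure A)%E.
    apply: le_measure; rewrite ?inE //.
    move=> x; rewrite /= in_itv /= => /andP[sx xt]; apply: sA => /= -[dp].
    suff -> : 'D_1 p x = w.
      by move=> e; apply: wN; rewrite -enorm_sqr e expr1n.
    have hc : \forall z \near x, p z = (fun u => x0 + u *: w) z.
      near=> z; apply: hw.
      apply/andP; split; apply/ltW; near: z; [exact: lt_nbhsr|exact: lt_nbhsl].
    by rewrite (near_eq_derive _ hc); apply: derive_val; exact: is_derive_line.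
  rewrite [lebesgue_measure A]A0 lebesgue_measure_itv /= lte_fin ainc -EFinB.
  by rewrite lee_fin subr_le0 leNgt ainc.
rewrite /sqdist /v /= !hw ?lexx ?ltW //.
rewrite opprD addrACA subrr add0r -scalerBl !edotE w1 aS addrC addKr mulr1.
by rewrite -invfM -expr2.
Unshelve. all: by end_near.
Qed.

(** The remainder in [inve_ge], with tangency at the regular chord. *)
Let deviation (i j : nat) : R :=
  (sqdist (v i) (v j) - regular_sqchord n (j%:R - i%:R)) ^+ 2 /
  ((sqdist (v i) (v j) + regular_sqchord n (j%:R - i%:R)) *
   regular_sqchord n (j%:R - i%:R) ^+ 2).

Let deviation_ge0 (i j : 'I_n) : j != i -> 0 <= deviation i j.
Proof.
move=> ji; have c0 := regular_sqchord_ord_gt0 (R := R) ji.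
rewrite divr_ge0 ?sqr_ge0 // mulr_ge0 ?sqr_ge0 // addr_ge0 ?sqdist_ge0 //.
exact: ltW.
Qed.

(** Apply [inve_ge] to every chord; by [regular_defect_ge0] the linear terms have a nonnegative
    sum. *)
Let mobius_energy_deviation :
  ((regular_energy n + (\sum_(i < n) \sum_(j < n | j != i) deviation i j) / n%:R / n%:R)%:E
   <= mobius_energy_at n p a)%E.
Proof.
have nR : (0 : R) < n%:R by rewrite ltr0n.
pose rc (i j : nat) : R := regular_sqchord n (j%:R - i%:R).
pose x (i j : nat) : R := sqdist (v i) (v j).
pose D (i j : nat) : R := circle_dist (j%:R / n%:R) (i%:R / n%:R) ^+ 2.
apply: (@le_trans _ _ (\sum_(i < n) \sum_(j < n | j != i)
   (((rc i j)^-1 + (rc i j - x i j) / rc i j ^+ 2 + deviation i j - (D i j)^-1)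
     / n%:R / n%:R)%:E)%E).
  under [leRHS]eq_bigr do rewrite sumEFin.
  rewrite sumEFin lee_fin.
  have -> : \sum_(i < n) \sum_(j < n | j != i)
      ((rc i j)^-1 + (rc i j - x i j) / rc i j ^+ 2 + deviation i j - (D i j)^-1)
       / n%:R / n%:R =
    regular_energy n + (\sum_(i < n) \sum_(j < n | j != i) deviation i j) / n%:R / n%:R
    + (\sum_(i < n) \sum_(j < n | j != i) (rc i j - x i j) / rc i j ^+ 2) / n%:R / n%:R.
    rewrite !mulr_suml -!big_split; apply: eq_bigr => i _ /=.
    rewrite !mulr_suml -!big_split; apply: eq_bigr => j _ /=.
    rewrite -/(rc i j) -/(D i j); ring.
  rewrite lerDl !mulr_ge0 ?invr_ge0 ?(ltW nR) //.
  exact: (regular_defect_ge0 n1 vertices_periodic sqdist_side).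
apply: lee_sum => i _; apply: lee_sum => j ji.
have [_ _ st _] := sa; rewrite !st (circle_dist_subdivision _ _ n0 sa).
have c0 := regular_sqchord_ord_gt0 (R := R) ji.
have d0 := circle_dist_gt0 (R := R) ji.
rewrite enorm_sqr [leLHS]EFinM; apply: lee_wpmul2r.
  by rewrite lee_fin invr_ge0 ltW.
rewrite [leLHS]EFinM; apply: lee_wpmul2r; first by rewrite lee_fin invr_ge0 ltW.
rewrite EFinB leeB //.
  by apply: inve_ge => //; exact: sqdist_ge0.
by rewrite inver gt_eqF ?exprn_gt0.
Qed.

Lemma mobius_energy_ge : ((regular_energy n)%:E <= mobius_energy_at n p a)%E.
Proof.
apply: le_trans mobius_energy_deviation; rewrite lee_fin lerDl.
rewrite !mulr_ge0 ?invr_ge0 ?ler0n // sumr_ge0 // => i _.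
by rewrite sumr_ge0 // => j; exact: deviation_ge0.
Qed.

(** The deviations are nonnegative with sum at most zero, so each of them vanishes. *)
Lemma mobius_energy_le_regular :
  (mobius_energy_at n p a <= (regular_energy n)%:E)%E -> chords_regular n v.
Proof.
move=> /(le_trans mobius_energy_deviation); rewrite lee_fin gerDl.
rewrite ler_pdivrMr ?ltr0n // mul0r ler_pdivrMr ?ltr0n // mul0r => h.
apply: chords_regularP => // [|i j ji]; first exact: vertices_periodic.
have c0 := regular_sqchord_ord_gt0 (R := R) ji.
have di0 (k : 'I_n) : 0 <= \sum_(l < n | l != k) deviation k l.
  by apply: sumr_ge0 => l; exact: deviation_ge0.
have : deviation i j = 0.
  apply/eqP; rewrite eq_le deviation_ge0 // andbT (le_trans _ h) //.
  rewrite (bigD1 i) //= (bigD1 j) //= -addrA lerDl addr_ge0 //.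
    by apply: sumr_ge0 => l /andP[li _]; exact: deviation_ge0.
  by apply: sumr_ge0 => k _.
move=> /eqP; rewrite mulf_eq0 invr_eq0 sqrf_eq0 subr_eq0 => /orP[/eqP //|].
have x0 := sqdist_ge0 (v i) (v j).
rewrite gt_eqF //; apply: mulr_gt0; last exact: exprn_gt0.
exact: ltr_wpDl.
Qed.

Lemma mobius_energy_regular :
  chords_regular n v -> mobius_energy_at n p a = (regular_energy n)%:E.
Proof.
move=> h; rewrite /mobius_energy_at /regular_energy -sumEFin; apply: eq_bigr => i _.
rewrite -sumEFin; apply: eq_bigr => j ji.
rewrite enorm_sqr -/(sqdist _ _) (h i j).
have [_ _ st _] := sa; rewrite !st (circle_dist_subdivision _ _ n0 sa).
have c0 := regular_sqchord_ord_gt0 (R := R) ji.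
have d0 := circle_dist_gt0 (R := R) ji.
by rewrite inver gt_eqF // inver gt_eqF ?exprn_gt0.
Qed.

End PolygonEnergy.

(** * Equally spaced points on a plane circle *)

Section Circle.
Context {R : realType}.
Implicit Types (h t u A B : R) (x y : nat -> R).

(** Successive points turn by [2 * h] about the centre, and [(A, B)] is the radius vector of point
    0. With the half angle [h], chords are given by sines of its multiples. *)
Definition circle_points h (x y : nat -> R) (A B : R) : Prop :=
  exists cx cy, forall i : nat,
    x i = cx + A * cos (2 * h * i%:R) - B * sin (2 * h * i%:R) /\
    y i = cy + A * sin (2 * h * i%:R) + B * cos (2 * h * i%:R).

Lemma cos2M t : cos (2 * t) = 1 - 2 * sin t ^+ 2.
Proof.
by rewrite mulr_natl cos_mulr2n -mulr_natl; have := cos2Dsin2 t; lra.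
Qed.

Lemma sin2M t : sin (2 * t) = 2 * sin t * cos t.
Proof. by rewrite mulr_natl sin_mulr2n -mulr_natl; ring. Qed.

(** The left side is twice the signed area of a triangle inscribed in the unit circle; the product
    makes its sign visible. *)
Lemma sin_three_angles t u :
  sin (2 * t) + sin (2 * u) - sin (2 * (t + u)) = 4 * sin t * sin u * sin (t + u).
Proof.
by rewrite mulrDr [sin (2 * t + _)]sinD !cos2M !sin2M sinD; ring.
Qed.

Lemma circle_points_det h x y A B i j : circle_points h x y A B ->
  planar_det x y i i.+1 j = 4 * (A ^+ 2 + B ^+ 2) * sin h *
    sin (h * (j%:R - i%:R)) * sin (h * (j%:R - i.+1%:R)).
Proof.
move=> [cx [cy xy]]; rewrite /planar_det.
have [-> ->] := xy i; have [-> ->] := xy i.+1; have [-> ->] := xy j.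
set a := 2 * h * i%:R; set b := 2 * h * i.+1%:R; set g := 2 * h * j%:R.
transitivity ((A ^+ 2 + B ^+ 2) * (sin (b - a) + sin (g - b) - sin (g - a))).
  by rewrite !sinB; ring.
have := sin_three_angles h (h * (j%:R - i.+1%:R)).
rewrite (_ : 2 * h = b - a); last by rewrite /a /b -natr1; ring.
rewrite (_ : 2 * (h * _) = g - b); last by rewrite /g /b; ring.
rewrite (_ : h + _ = h * (j%:R - i%:R)); last by rewrite -natr1; ring.
rewrite (_ : 2 * (h * _) = g - a); last by rewrite /g /a; ring.
by move=> ->; ring.
Qed.

Lemma circle_points_sqdist h x y A B i j : circle_points h x y A B ->
  (x j - x i) ^+ 2 + (y j - y i) ^+ 2 =
  4 * (A ^+ 2 + B ^+ 2) * sin (h * (j%:R - i%:R)) ^+ 2.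
Proof.
move=> [cx [cy xy]]; have [-> ->] := xy i; have [-> ->] := xy j.
set a := 2 * h * i%:R; set g := 2 * h * j%:R.
have := cos2M (h * (j%:R - i%:R)).
rewrite (_ : 2 * (h * _) = g - a); last by rewrite /g /a; ring.
rewrite cosB => H.
have := cos2Dsin2 a; have := cos2Dsin2 g => Hg Ha.
transitivity ((A ^+ 2 + B ^+ 2) * ((cos g ^+ 2 + sin g ^+ 2) +
  (cos a ^+ 2 + sin a ^+ 2) - 2 * (cos g * cos a + sin g * sin a))); first by ring.
by rewrite Ha Hg H; ring.
Qed.

(** With [K = 1 + 2 cos P], the number [exp (i P)] is a root of [z^3 - K z^2 + K z - 1 = (z - 1)
    (z^2 - 2 z cos P + 1)]. *)
Lemma circle_recurrence t P :
  cos (t + 3 * P) = cos t + (1 + 2 * cos P) * (cos (t + 2 * P) - cos (t + P)) /\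
  sin (t + 3 * P) = sin t + (1 + 2 * cos P) * (sin (t + 2 * P) - sin (t + P)).
Proof.
have [z ->] : exists z, t = z - P by exists (t + P); ring.
rewrite (_ : z - P + 3 * P = z + 2 * P); last by ring.
rewrite (_ : z - P + 2 * P = z + P); last by ring.
rewrite subrK.
rewrite !(cosD z) !(sinD z) cosN sinN sin2M.
have -> : cos (2 * P) = 2 * cos P ^+ 2 - 1.
  by rewrite cos2M; have := cos2Dsin2 P; lra.
by split; ring.
Qed.

Lemma planar_sqdist {d : nat} (c e f : 'rV[R]_d) (x1 y1 x2 y2 : R) :
  edot e e = 1 -> edot f f = 1 -> edot e f = 0 ->
  sqdist (c + x1 *: e + y1 *: f) (c + x2 *: e + y2 *: f) =
  (x2 - x1) ^+ 2 + (y2 - y1) ^+ 2.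
Proof.
move=> ee ff ef; have fe : edot f e = 0 by rewrite edotC.
have -> : sqdist (c + x1 *: e + y1 *: f) (c + x2 *: e + y2 *: f) =
    edot ((x2 - x1) *: e + (y2 - y1) *: f) ((x2 - x1) *: e + (y2 - y1) *: f).
  by congr edot; apply/rowP => k; rewrite !mxE; ring.
by rewrite !edotE ee ff ef fe; ring.
Qed.

End Circle.

(** * From regular chords to regular vertices *)

Section RegularVertices.
Context {R : realType} {d : nat}.
Variables (n : nat) (v : nat -> 'rV[R]_d).
Hypothesis n3 : (3 <= n)%N.
Hypothesis vn : forall i, v (i + n)%N = v i.

Let h : R := pi / n%:R.

Let nR : (0 : R) < n%:R. Proof. by rewrite ltr0n; lia. Qed.

Let sh : 0 < sin h.
Proof. by rewrite -[h]mul1r (@sin_angle_gt0 _ n 1) //; lia. Qed.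

Let ch : 0 < cos h.
Proof.
apply: cos_gt0_pihalf; have p0 := pi_gt0 R; apply/andP; split.
  by apply: (@lt_trans _ _ 0); rewrite ?oppr_lt0 divr_gt0.
by rewrite ltr_pM2l // ltf_pV2 ?posrE // (ltr_nat R 2).
Qed.

(** Since [K = sin (3 h) / sin h], the squared norm of [U] is [K^2] times that of [W]. The
    quadrilateral identity makes their inner product [K] times that of [W] with itself, so
    [U - K *: W] has norm zero. *)
Lemma chords_regular_recurrence : chords_regular n v -> forall i,
  v (i + 3)%N = v i + (1 + 2 * cos (2 * h)) *: (v (i + 2)%N - v (i + 1)%N).
Proof.
move=> vR i; set K := 1 + 2 * cos (2 * h).
have dist k m t : m%:R - k%:R = t :> R ->
    sqdist (v k) (v m) = (sin (t * h)) ^+ 2 / (n%:R * sin h) ^+ 2.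
  by move=> <-; rewrite vR /regular_sqchord -/h exprMn exprVn.
have cE : cos h ^+ 2 = 1 - sin h ^+ 2 by have := cos2Dsin2 h; lra.
have s2 : sin (2 * h) ^+ 2 = 4 * cos h ^+ 2 * sin h ^+ 2 by rewrite sin2M; ring.
have s3 : sin (3 * h) = K * sin h.
  rewrite (_ : 3 * h = 2 * h + h); last by ring.
  rewrite sinD sin2M -mulrA -expr2 cE /K cos2M; ring.
have KE : K = 4 * cos h ^+ 2 - 1 by rewrite cE /K cos2M; ring.
set L := n%:R ^- 2 : R.
have d1 k m : m%:R - k%:R = 1 :> R -> sqdist (v k) (v m) = L.
  by move=> /dist ->; rewrite mul1r /L; field; rewrite !gt_eqF.
have d2 k m : m%:R - k%:R = 2 :> R -> sqdist (v k) (v m) = 4 * cos h ^+ 2 * L.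
  by move=> /dist ->; rewrite s2 /L; field; rewrite !gt_eqF.
have d3 k m : m%:R - k%:R = 3 :> R -> sqdist (v k) (v m) = K ^+ 2 * L.
  by move=> /dist ->; rewrite s3 /L; field; rewrite !gt_eqF.
have q := quadrilateral_sqdist (v i) (v (i + 1)%N) (v (i + 2)%N) (v (i + 3)%N).
rewrite (d2 i) in q; last by rewrite natrD; ring.
rewrite (d2 (i + 1)%N) in q; last by rewrite !natrD; ring.
rewrite (d1 i) in q; last by rewrite !natrD; ring.
rewrite (d1 (i + 2)%N) in q; last by rewrite !natrD; ring.
have u := d3 i (i + 3)%N; have w := d1 (i + 1)%N (i + 2)%N.
rewrite /sqdist in u w.
set U := v (i + 3)%N - v i in u q; set W := v (i + 2)%N - v (i + 1)%N in w q *.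
have : edot (U - K *: W) (U - K *: W) = 0.
  rewrite edot_subZ u; last by rewrite !natrD; ring.
  rewrite w; last by rewrite !natrD; ring.
  have -> : edot U W = K * L by rewrite KE; lra.
  ring.
by move=> /edot_eq0/eqP; rewrite /U subr_eq0 subr_eq addrC => /eqP.
Qed.

(** By [circle_recurrence] the points on the circle through the first three vertices obey the same
    recurrence as the vertices. *)
Lemma chords_regular_circle : chords_regular n v ->
  exists c e f : 'rV[R]_d, exists x y : nat -> R, exists A B : R,
    [/\ [/\ edot e e = 1, edot f f = 1 & edot e f = 0],
        forall i, v i = c + x i *: e + y i *: f,
        circle_points h x y A B & 0 < A ^+ 2 + B ^+ 2].
Proof.
move=> vR.
have [a aE] : exists a, a = v 1%N - v 0%N by exists (v 1%N - v 0%N).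
have [b bE] : exists b, b = v 1%N - v 2%N by exists (v 1%N - v 2%N).
pose l : R := n%:R^-1; pose s := sin h; pose k := cos h.
have l0 : 0 < l by rewrite invr_gt0.
have sE : s ^+ 2 = 1 - k ^+ 2 by have := cos2Dsin2 h; rewrite /s /k; lra.
(* [e] points from the centre to [v 1], [f] along the chord from [v 0] to [v 2], and [r] is the
   circumradius. *)
pose e := (2 * l * s)^-1 *: (a + b); pose f := (2 * l * k)^-1 *: (a - b).
pose r := l / (2 * s).
have aa : edot a a = l ^+ 2.
  have := vR 0%N 1%N; rewrite subr0 regular_sqchord1; last by lia.
  by rewrite /sqdist -aE /l exprVn.
have bb : edot b b = l ^+ 2.
  have := vR 2%N 1%N; rewrite -opprB regular_sqchordN.
  rewrite (_ : _ - _ = 1); last by ring.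
  rewrite regular_sqchord1; last by lia.
  by rewrite /sqdist -bE /l exprVn.
have ab : edot a b = l ^+ 2 - 2 * k ^+ 2 * l ^+ 2.
  have := vR 0%N 2%N; rewrite subr0 /regular_sqchord -/h sin2M -/s -/k.
  rewrite /sqdist (_ : _ - _ = a - b); last first.
    by rewrite aE bE; apply/rowP => z; rewrite !mxE; ring.
  rewrite edotB aa bb.
  rewrite (_ : (_ / _) ^+ 2 = 4 * k ^+ 2 * l ^+ 2); first by lra.
  by rewrite /l; field; rewrite !gt_eqF.
exists (v 1%N - r *: e), e, f.
(* Angles are measured from [v 1], hence the shift by [2 * h]. *)
pose x (i : nat) := r * cos (2 * h * i%:R - 2 * h).
pose y (i : nat) := r * sin (2 * h * i%:R - 2 * h).
exists x, y.
exists (r * cos (2 * h)), (- (r * sin (2 * h))); split.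
- split.
  + rewrite /e !edotE (edotC b a) aa bb ab.
    transitivity ((4 * l ^+ 2 * (1 - k ^+ 2)) / (2 * l * s) ^+ 2).
      by field; rewrite !gt_eqF.
    by rewrite -sE; field; rewrite !gt_eqF.
  + rewrite /f !edotE (edotC b a) aa bb ab.
    by field; rewrite !gt_eqF.
  + by rewrite /e /f !edotE (edotC b a) aa bb; ring.
- have rec := chords_regular_recurrence vR.
  have v0 : v 0%N = v 1%N - r *: e + x 0%N *: e + y 0%N *: f.
    rewrite /x /y mulr0 sub0r cosN sinN cos2M sin2M /e /f /r -/s -/k.
    rewrite aE bE; apply/rowP => z; rewrite !mxE.
    by field; rewrite !gt_eqF.
  have v1 : v 1%N = v 1%N - r *: e + x 1%N *: e + y 1%N *: f.
    by rewrite /x /y !mulr1 !subrr cos0 sin0 mulr1 mulr0 scale0r addr0 subrK.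
  have v2 : v 2%N = v 1%N - r *: e + x 2%N *: e + y 2%N *: f.
    rewrite /x /y (_ : 2 * h * _ - _ = 2 * h); last by ring.
    rewrite cos2M sin2M /e /f /r -/s -/k aE bE; apply/rowP => z; rewrite !mxE.
    by field; rewrite !gt_eqF.
  suff H i : [/\ v i = v 1%N - r *: e + x i *: e + y i *: f,
      v (i + 1)%N = v 1%N - r *: e + x (i + 1)%N *: e + y (i + 1)%N *: f &
      v (i + 2)%N = v 1%N - r *: e + x (i + 2)%N *: e + y (i + 2)%N *: f].
    by move=> i; case: (H i).
  elim: i => [|i [H0 H1 H2]]; first by split.
  split; [by rewrite -[i.+1]addn1|by rewrite addSnnS|rewrite addSnnS].
  rewrite rec H0 H1 H2 /x /y !natrD.
  have := circle_recurrence (2 * h * i%:R - 2 * h) (2 * h).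
  set u := 2 * h * i%:R - 2 * h.
  rewrite (_ : u + 3 * (2 * h) = 2 * h * (i%:R + 3) - 2 * h); last by rewrite /u; ring.
  rewrite (_ : u + 2 * (2 * h) = 2 * h * (i%:R + 2) - 2 * h); last by rewrite /u; ring.
  rewrite (_ : u + 2 * h = 2 * h * (i%:R + 1) - 2 * h); last by rewrite /u; ring.
  move=> [-> ->]; apply/rowP => z; rewrite !mxE.
  ring.
- exists 0, 0 => i; rewrite /x /y cosB sinB; split; ring.
- rewrite (_ : _ + _ = r ^+ 2 * (cos (2 * h) ^+ 2 + sin (2 * h) ^+ 2)); last by ring.
  by rewrite cos2Dsin2 mulr1 exprn_gt0 // divr_gt0 // mulr_gt0.
Qed.

Lemma chords_regular_vertices : chords_regular n v -> regular_vertices n v.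
Proof.
move=> vR; split.
- have [c [e [f [x [y [A [B [[ee ff ef] vE xy AB]]]]]]]] := chords_regular_circle vR.
  exists c, e, f, x, y; split=> // i j ji jSi.
  have [cx [cy xyE]] := xy.
  have per m : x (m + n)%N = x m /\ y (m + n)%N = y m.
    have := xyE (m + n)%N; have := xyE m => -[-> ->].
    rewrite natrD (_ : 2 * h * (_ + _) = 2 * h * m%:R + pi *+ 2).
      by rewrite sinD2pi cosD2pi.
    by rewrite mulrDr /h -[pi *+ 2]mulr_natl; field; rewrite gt_eqF.
  have detn m : planar_det x y i i.+1 (m + n)%N = planar_det x y i i.+1 m.
    by rewrite /planar_det; have [-> ->] := per m.
  have detq m q : planar_det x y i i.+1 (m + q * n)%N = planar_det x y i i.+1 m.
    by elim: q => [|q IH]; rewrite ?addn0 // mulSn [(n + _)%N]addnC addnA detn.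
  (* The residue of [j - i]; adding [i * n] avoids truncated subtraction. It is at least 2 by the
     two conditions on [j], which makes every sine in the determinant positive. *)
  pose m := ((j + i * n - i) %% n)%N.
  have e1 : (j + i * n = i + m + ((j + i * n - i) %/ n) * n)%N.
    by rewrite -addnA [(m + _)%N]addnC -divn_eq subnKC //; nia.
  have m_lt : (m < n)%N by rewrite ltn_mod; lia.
  have jm : j = i + m %[mod n].
    by rewrite -(modnMDl i j) addnC e1 [(_ + _ * n)%N]addnC modnMDl.
  have m2 : (2 <= m)%N.
    move: ji jSi; rewrite jm; case: (m) => [|[|//]]; rewrite ?addn0 ?eqxx //.
    by rewrite addn1 eqxx.
  rewrite -(detq j i) e1 detq (circle_points_det _ _ xy).
  rewrite (_ : (i + m)%:R - i%:R = m%:R); last by rewrite natrD; ring.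
  rewrite (_ : (i + m)%:R - i.+1%:R = (m.-1)%:R); last first.
    by rewrite -natr1 natrD -subn1 natrB; [ring|lia].
  rewrite ![h * _]mulrC; apply: mulr_gt0; last by apply: sin_angle_gt0; lia.
  by apply: mulr_gt0; [apply: mulr_gt0 => //; apply: mulr_gt0|apply: sin_angle_gt0; lia].
- move=> i j; rewrite /enorm -!/(sqdist _ _) !vR -!natr1.
  by rewrite ![_ + 1 - _]addrAC !subrr.
(* By the law of cosines, the chords of spans 1 and 2 determine the angle. *)
- suff H i : eangle (v i) (v i.+1) (v i.+2) =
      acos ((regular_sqchord n 1 + regular_sqchord n 1 - regular_sqchord n 2) / 2 /
        (Num.sqrt (regular_sqchord n 1) * Num.sqrt (regular_sqchord n 1))).
    by move=> i j; rewrite !H.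
  have e1 : edot (v i - v i.+1) (v i - v i.+1) = regular_sqchord n 1.
    rewrite -/(sqdist _ _) vR -natr1 -opprB regular_sqchordN; congr regular_sqchord; ring.
  have e2 : edot (v i.+2 - v i.+1) (v i.+2 - v i.+1) = regular_sqchord n 1.
    rewrite -/(sqdist _ _) vR -!natr1; congr regular_sqchord; ring.
  rewrite /eangle /enorm e1 e2; congr (acos (_ / _)).
  have := vR i i.+2; rewrite (_ : i.+2%:R - i%:R = 2); last by rewrite -!natr1; ring.
  rewrite /sqdist (_ : v i.+2 - v i = (v i.+2 - v i.+1) - (v i - v i.+1)); last first.
    by apply/rowP => z; rewrite !mxE; ring.
  set a := v i - _ in e1 *; set b := v i.+2 - v i.+1 in e2 *.
  rewrite edotB (edotC b a) e1 e2; lra.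
Qed.

End RegularVertices.

(** * From regular vertices to regular chords *)

(** The points are partial sums of a geometric series of edges, whose ratio differs from 1 because
    [sin h != 0]. *)
Lemma rotation_circle {R : realType} (h : R) (x y : nat -> R) : sin h != 0 ->
  (forall i, x i.+2 - x i.+1 = cos (2 * h) * (x i.+1 - x i) - sin (2 * h) * (y i.+1 - y i)
          /\ y i.+2 - y i.+1 = sin (2 * h) * (x i.+1 - x i) + cos (2 * h) * (y i.+1 - y i)) ->
  exists A B, circle_points h x y A B.
Proof.
move=> s0 rot; set p := x 1%N - x 0%N; set q := y 1%N - y 0%N.
pose C := cos (2 * h); pose S := sin (2 * h).
have D0 : (C - 1) ^+ 2 + S ^+ 2 != 0.
  rewrite (_ : _ + _ = 4 * sin h ^+ 2 * (cos h ^+ 2 + sin h ^+ 2)).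
    by rewrite cos2Dsin2 mulr1 mulf_neq0 ?expf_neq0 // pnatr_eq0.
  by rewrite /C /S cos2M sin2M; ring.
(* In complex form, [A + i B = (p + i q) / (exp (2 i h) - 1)]. *)
pose A := (p * (C - 1) + q * S) / ((C - 1) ^+ 2 + S ^+ 2).
pose B := (q * (C - 1) - p * S) / ((C - 1) ^+ 2 + S ^+ 2).
have pE : p = A * (C - 1) - B * S by rewrite /A /B; field.
have qE : q = A * S + B * (C - 1) by rewrite /A /B; field.
have angS i : 2 * h * i.+1%:R = 2 * h * i%:R + 2 * h.
  by rewrite -(natr1 i); ring.
have step i : x i.+1 - x i = p * cos (2 * h * i%:R) - q * sin (2 * h * i%:R) /\
              y i.+1 - y i = p * sin (2 * h * i%:R) + q * cos (2 * h * i%:R).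
  elim: i => [|i [IHx IHy]].
    by rewrite mulr0 cos0 sin0 !mulr1 !mulr0 subr0 add0r.
  have [-> ->] := rot i; rewrite IHx IHy angS cosD sinD.
  by split; ring.
exists A, B, (x 0%N - A), (y 0%N - B); elim => [|i [IHx IHy]].
  by rewrite mulr0 cos0 sin0; split; ring.
have [hx hy] := step i.
rewrite -(subrK (x i) (x i.+1)) -(subrK (y i) (y i.+1)) hx hy IHx IHy.
rewrite angS cosD sinD -/C -/S; set cx := x 0%N; set cy := y 0%N.
rewrite pE qE.
by split; ring.
Qed.

(* For a polygon with exterior angle [2 * h], this says that convexity forces the
   turning number to be one. *)
Lemma sin_multiples_pos {R : realType} (n : nat) (h : R) :
  (3 <= n)%N -> 0 < h < pi / 2 ->
  (forall k : nat, (0 < k < n)%N -> 0 < sin (h * k%:R)) ->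
  sin (h * n%:R) = 0 -> h = pi / n%:R.
Proof.
move=> n3 /andP[h0 h2] pos sn0.
have sin_le0 (x : R) : pi < x < pi + pi -> sin x < 0.
  move=> /andP[x1 x2]; rewrite -(subrK pi x) sinDpi oppr_lt0.
  by apply: sin_gt0_pi; apply/andP; split; lra.
(* Each step adds less than [pi], so a first multiple not below [pi] would land where the sine is
   not positive. *)
have lt_pi k : (k < n)%N -> h * k%:R < pi.
  elim: k => [|k IH] kn; first by rewrite mulr0 pi_gt0.
  have {}IH := IH (ltnW kn); have hk := pos k.+1 kn.
  rewrite ltNge le_eqVlt; apply/negP => /orP[/eqP e|hlt].
    by move: hk; rewrite -e sinpi ltxx.
  have : sin (h * k.+1%:R) < 0.
    by apply: sin_le0; rewrite hlt -natr1 mulrDr mulr1; lra.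
  by move=> /(lt_trans hk); rewrite ltxx.
have nE : h * n%:R = pi.
  have n1 : (n.-1 < n)%N by lia.
  have := lt_pi _ n1; have : h * n%:R = h * n.-1%:R + h.
    by rewrite -{1}(prednK (_ : 0 < n)%N) ?(ltn_trans _ n3) // -natr1; ring.
  move=> e lt; have nh : h * n%:R < pi + pi by lra.
  case: (ltgtP (h * n%:R) pi) => // H.
    have : 0 < sin (h * n%:R).
      by apply: sin_gt0_pi; rewrite H mulr_gt0 // ltr0n; lia.
    by rewrite sn0 ltxx.
  have : sin (h * n%:R) < 0 by apply: sin_le0; rewrite H.
  by rewrite sn0 ltxx.
by rewrite -nE mulfK // pnatr_eq0; lia.
Qed.

(** This lets [cos] cancel [acos] in [eangle]. Zero vectors are covered, as division by zero gives
    zero. *)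
Lemma edot_cauchy_schwarz {R : realType} {d : nat} (u w : 'rV[R]_d) :
  -1 <= edot u w / (enorm u * enorm w) <= 1.
Proof.
have := enorm_ge0 u; rewrite le_eqVlt => /orP[/eqP <-|u0].
  by rewrite mul0r invr0 mulr0 lerN10 ler01.
have := enorm_ge0 w; rewrite le_eqVlt => /orP[/eqP <-|w0].
  by rewrite mulr0 invr0 mulr0 lerN10 ler01.
have uw : 0 < enorm u * enorm w by rewrite mulr_gt0.
rewrite ler_pdivrMr // ler_pdivlMr // mulN1r mul1r.
have h k k' := edot_amgm k k' u w.
have h1 := h (enorm w) (enorm u); have h2 := h (enorm w) (- enorm u).
rewrite -!enorm_sqr in h1 h2.
have e1 : 2 * (enorm u * enorm w) * edot u w <=
          2 * (enorm u * enorm w) * (enorm u * enorm w) by lra.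
have e2 : 2 * (enorm u * enorm w) * (- (enorm u * enorm w)) <=
          2 * (enorm u * enorm w) * edot u w by lra.
rewrite !ler_pM2l ?mulr_gt0 // in e1 e2.
by rewrite e1 e2.
Qed.

Lemma addn_neq_mod (n i k : nat) : (0 < k < n)%N -> (i + k != i %[mod n])%N.
Proof.
move=> /andP[k0 kn]; rewrite -[X in _ != X %[mod n]]addn0 eqn_modDl.
by rewrite mod0n modn_small // -lt0n.
Qed.

Section RegularVerticesConverse.
Context {R : realType} {d : nat}.
Variables (n : nat) (v : nat -> 'rV[R]_d).
Hypothesis n3 : (3 <= n)%N.
Hypothesis vn : forall i, v (i + n)%N = v i.
Hypothesis side : forall i, sqdist (v i) (v i.+1) = n%:R ^- 2.

Let nR : (0 : R) < n%:R. Proof. by rewrite ltr0n; lia. Qed.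

(** [T] is the cosine of the exterior angle, minus that of [eangle], where one edge is reversed. *)
Lemma regular_vertices_angle : regular_vertices n v ->
  exists T, forall i, edot (v i.+1 - v i) (v i.+2 - v i.+1) = T * n%:R ^- 2.
Proof.
move=> [_ _ ang].
exists (edot (v 1%N - v 0%N) (v 2%N - v 1%N) * n%:R ^+ 2) => i.
have side' j : enorm (v j - v j.+1) = n%:R^-1.
  rewrite /enorm -/(sqdist _ _) sqdistC side sqrtrV ?exprn_ge0 ?ltW //.
  by rewrite sqrtr_sqr gtr0_norm.
have side2 j : enorm (v j.+1 - v j) = n%:R^-1.
  rewrite /enorm -/(sqdist _ _) side sqrtrV ?exprn_ge0 ?ltW //.
  by rewrite sqrtr_sqr gtr0_norm.
have := congr1 cos (ang i 0%N); rewrite /eangle.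
rewrite !acosK ?in_itv /= ?edot_cauchy_schwarz // !side' !side2.
move=> /(mulIf _) H; apply: oppr_inj; rewrite -edotNl opprB H.
  by rewrite -[v 0%N - _]opprB edotNl; field; rewrite gt_eqF.
by rewrite invr_eq0 mulf_neq0 // invr_eq0 gt_eqF.
Qed.

(** Each edge is the previous one turned by a fixed angle, so the vertices lie on a circle.
    Convexity and closing up fix the angle, and the side length fixes the radius. *)
Lemma regular_vertices_chords : regular_vertices n v -> chords_regular n v.
Proof.
move=> vR; have [T dotE] := regular_vertices_angle vR.
have [[c [e [f [x [y [ee ff ef vE conv]]]]]] _ _] := vR.
pose p i := x i.+1 - x i; pose q i := y i.+1 - y i.
have wE i : v i.+1 - v i = p i *: e + q i *: f.
  by rewrite !vE /p /q; apply/rowP => z; rewrite !mxE; ring.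
have fe : edot f e = 0 by rewrite edotC.
have pq i : p i ^+ 2 + q i ^+ 2 = n%:R ^- 2.
  by have := side i; rewrite !vE planar_sqdist.
have dotpq i : p i * p i.+1 + q i * q i.+1 = T * n%:R ^- 2.
  by rewrite -(dotE i) !wE !edotE ee ff ef fe; ring.
pose S := Num.sqrt (1 - T ^+ 2).
have detpos i : 0 < p i * q i.+1 - q i * p i.+1.
  have := conv i i.+2; rewrite (_ : planar_det _ _ _ _ _ = p i * q i.+1 - q i * p i.+1).
    apply; first by rewrite -addn2 addn_neq_mod //; lia.
    by rewrite -addn1 addn_neq_mod //; lia.
  by rewrite /planar_det /p /q; ring.
have detE i : p i * q i.+1 - q i * p i.+1 = S * n%:R ^- 2 /\ 0 < 1 - T ^+ 2.
  (* Lagrange's identity: lengths and inner product give the determinant up to sign, and convexity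
     gives the sign. *)
  have lag : (p i * q i.+1 - q i * p i.+1) ^+ 2 = (1 - T ^+ 2) * (n%:R ^- 2) ^+ 2.
    transitivity ((p i ^+ 2 + q i ^+ 2) * (p i.+1 ^+ 2 + q i.+1 ^+ 2) -
       (p i * p i.+1 + q i * q i.+1) ^+ 2); first by ring.
    by rewrite !pq dotpq; ring.
  have T0 : 0 < 1 - T ^+ 2.
    have := exprn_gt0 2 (detpos i); rewrite lag pmulr_lgt0 //.
    by rewrite exprn_gt0 // invr_gt0 exprn_gt0.
  split=> //; have := congr1 Num.sqrt lag.
  rewrite sqrtr_sqr gtr0_norm // => ->.
  by rewrite sqrtrM ?(ltW T0) // sqrtr_sqr gtr0_norm // invr_gt0 exprn_gt0.
have T1 : -1 < T < 1.
  have [_] := detE 0%N; rewrite subr_gt0 -(real_normK (num_real T)) expr_lt1 //.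
  by rewrite ltr_norml.
have T1' : -1 <= T <= 1 by case/andP: T1 => /ltW -> /ltW ->.
pose h := acos T / 2.
have h2 : 2 * h = acos T by rewrite /h; field.
have h0 : 0 < h < pi / 2.
  case/andP: T1 => Ta Tb; rewrite /h ltr_pM2r ?invr_gt0 // acos_ltpi ?Ta ?ltW //.
  by rewrite divr_gt0 // acos_gt0 // Tb ltW.
have CE : cos (2 * h) = T by rewrite h2 acosK // in_itv.
have SE : sin (2 * h) = S by rewrite h2 sin_acos.
have sh : 0 < sin h.
  by case/andP: h0 => ? ?; apply: sin_gt0_pi; apply/andP; split => //; have := pi_gt0 R; lra.
have [A [B xy]] : exists A B, circle_points h x y A B.
  apply: rotation_circle; first by rewrite gt_eqF.
  move=> i; rewrite CE SE -!/(p _) -!/(q _).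
  have nN : (n%:R ^- 2 : R) != 0 by rewrite invr_eq0 expf_neq0 // gt_eqF.
  have [Si _] := detE i; have Ti := dotpq i; have Pi := pq i.
  (* Multiplied by the squared edge length, the rotation formulas become identities between inner
     products and determinants. *)
  split; apply: (mulIf nN).
    transitivity (p i * (T * n%:R ^- 2) - q i * (S * n%:R ^- 2)); last by ring.
    by rewrite -Si -Ti -{1}Pi; ring.
  transitivity (p i * (S * n%:R ^- 2) + q i * (T * n%:R ^- 2)); last by ring.
  by rewrite -Si -Ti -{1}Pi; ring.
have sqE i j : sqdist (v i) (v j) =
    4 * (A ^+ 2 + B ^+ 2) * sin (h * (j%:R - i%:R)) ^+ 2.
  by rewrite !vE planar_sqdist // (circle_points_sqdist _ _ xy).
have ABs : 4 * (A ^+ 2 + B ^+ 2) * sin h ^+ 2 = n%:R ^- 2.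
  by rewrite -(side 0%N) sqE subr0 mulr1.
have AB : 0 < A ^+ 2 + B ^+ 2.
  have : 0 < 4 * (A ^+ 2 + B ^+ 2) * sin h ^+ 2.
    by rewrite ABs invr_gt0 exprn_gt0.
  by rewrite pmulr_lgt0 ?exprn_gt0 // pmulr_rgt0.
(* Convexity at the side from [v 0] to [v 1] makes the product of the sines of successive multiples
   of [h] positive, so positivity propagates. *)
have pos k : (0 < k < n)%N -> 0 < sin (h * k%:R).
  elim: k => // -[|k] IH /= kn; first by rewrite mulr1.
  have := conv 0%N k.+2; rewrite (circle_points_det _ _ xy).
  have k2 : k.+2 != 0 %[mod n] by rewrite -(add0n k.+2) addn_neq_mod.
  have k1 : k.+2 != 1 %[mod n] by rewrite -(add1n k.+1) addn_neq_mod //= ltnW.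
  move=> /(_ k2 k1).
  rewrite subr0 -[k.+2%:R - 1](_ : k.+1%:R = _); last by rewrite -natr1; ring.
  rewrite pmulr_lgt0; last by apply: IH; exact: ltnW.
  by rewrite pmulr_rgt0 // mulr_gt0 // mulr_gt0.
have hE : h = pi / n%:R.
  (* Closing up, [v n = v 0], makes the sine of [h * n] vanish. *)
  apply: sin_multiples_pos => //; have := sqdistxx (v 0%N).
  rewrite -{2}(vn 0) add0n sqE subr0 => /eqP.
  by rewrite mulf_eq0 sqrf_eq0 gt_eqF /= => [/eqP|]; rewrite ?mulr_gt0.
move=> i j; rewrite sqE /regular_sqchord -hE [_ * h]mulrC.
have nN : n%:R != 0 :> R by rewrite gt_eqF.
have shN : sin h != 0 by rewrite gt_eqF.
rewrite (_ : (_ / _) ^+ 2 = sin (h * (j%:R - i%:R)) ^+ 2 * n%:R ^- 2 / sin h ^+ 2).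
  by rewrite -ABs; field.
by field; rewrite nN shN.
Qed.

End RegularVerticesConverse.

(** * The closed polygon with prescribed vertices *)

Section PiecewiseAffine.
Context {R : realType} {d : nat}.
Variables (n : nat) (V : int -> 'rV[R]_d).
Hypothesis n1 : (1 < n)%N.
Hypothesis Vn : forall k, V (k + n%:Z) = V k.
Hypothesis side : forall k, sqdist (V k) (V (k + 1)) = n%:R ^- 2.

Let nR : (0 : R) < n%:R. Proof. by rewrite ltr0n ltnW. Qed.

Definition interpolation (t : R) : 'rV[R]_d :=
  let m := Num.floor (n%:R * t) in
  V m + (n%:R * t - m%:~R) *: (V (m + 1) - V m).

(** At the right endpoint the floor is already [m + 1], but both affine formulas give
    [V (m + 1)]. *)
Lemma interpolationE (m : int) (t : R) : m%:~R <= n%:R * t <= (m + 1)%:~R ->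
  interpolation t = V m + (n%:R * t - m%:~R) *: (V (m + 1) - V m).
Proof.
move=> /andP[mt]; rewrite le_eqVlt => /orP[/eqP tm|tm].
  rewrite /interpolation tm intrKfloor subrr scale0r addr0.
  by rewrite intrD [m%:~R + _]addrC addrK scale1r [V m + _]addrC subrK.
by rewrite /interpolation (floor_def (m := m)) // mt.
Qed.

Lemma interpolation_vertex (k : int) : interpolation (k%:~R / n%:R) = V k.
Proof.
rewrite (interpolationE (m := k)) mulrC divfK ?gt_eqF //.
  by rewrite subrr scale0r addr0.
by rewrite lexx ler_int lerDl.
Qed.

(* Around a breakpoint the two affine pieces are glued by
   [max z 0 = (z + `|z|) / 2] and [min z 0 = (z - `|z|) / 2]. *)
Lemma interpolation_near (m : int) (t : R) :
  (m - 1)%:~R < n%:R * t < (m + 1)%:~R ->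
  let z := n%:R * t - m%:~R in
  interpolation t = V m + (2^-1 * (z + `|z|)) *: (V (m + 1) - V m)
                        + (2^-1 * (z - `|z|)) *: (V m - V (m - 1)).
Proof.
move=> /andP[m1t tm1] z; have [z0|z0] := leP 0 z.
  rewrite ger0_norm // subrr mulr0 scale0r addr0.
  rewrite (interpolationE (m := m)); last by rewrite (ltW tm1) -subr_ge0 z0.
  by congr (_ + _ *: _); rewrite -/z; field.
rewrite ltr0_norm // subrr mulr0 scale0r addr0 opprK.
rewrite (interpolationE (m := m - 1)); last by rewrite (ltW m1t) subrK -subr_le0 ltW.
by rewrite subrK intrB /z; apply/rowP => k; rewrite !mxE; field.
Qed.

Lemma interpolation_continuous : continuous interpolation.
Proof.
move=> t; pose m := Num.floor (n%:R * t).
have /andP[mt tm] := floor_itv (n%:R * t).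
pose z (u : R) := n%:R * u - m%:~R.
pose g (u : R) := V m + (2^-1 * (z u + `|z u|)) *: (V (m + 1) - V m)
                      + (2^-1 * (z u - `|z u|)) *: (V m - V (m - 1)).
have hg : \forall u \near t, g u = interpolation u.
  near=> u; rewrite /g -interpolation_near //; apply/andP; split.
    rewrite mulrC -ltr_pdivrMr //; near: u; apply: lt_nbhsr.
    rewrite ltr_pdivrMr // mulrC (lt_le_trans _ mt) // ltr_int.
    by rewrite ltrBlDr ltrDl.
  by rewrite mulrC -ltr_pdivlMr //; near: u; apply: lt_nbhsl;
    rewrite ltr_pdivlMr // mulrC.
have cz : z u @[u --> t] --> z t.
  by apply: cvgB; [exact: cvgMl_tmp|exact: cvg_cst].
have cg : g u @[u --> t] --> g t.
  apply: cvgD; [apply: cvgD; first exact: cvg_cst|]; apply: cvgZr_tmp; apply: cvgMl_tmp.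
    by apply: cvgD => //; exact: cvg_norm.
  by apply: cvgB => //; exact: cvg_norm.
rewrite /continuous_at -(nbhs_singleton hg).
by apply: cvg_trans cg; apply: near_eq_cvg.
Unshelve. all: by end_near.
Qed.

Lemma interpolation_affine (m : int) (t : R) : m%:~R <= n%:R * t <= (m + 1)%:~R ->
  interpolation t =
  (V m - m%:~R *: (V (m + 1) - V m)) + t *: (n%:R *: (V (m + 1) - V m)).
Proof.
by move=> /interpolationE ->; apply/rowP => k; rewrite !mxE; ring.
Qed.

(** Off the countable set of breakpoints [k / n] the curve is locally affine, with velocity [n]
    times a side. *)
Lemma interpolation_unit_speed : unit_speed interpolation.
Proof.
pose A : set R := range (fun k : int => k%:~R / n%:R).
have cA : countable A.
  by apply: card_le_trans (card_image_le _ _) _; exact: countableP.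
exists A; split.
- by apply: countable_measurable => // t; exact: measurable_set1.
- exact: countable_lebesgue_measure0.
move=> t /= Nt; apply: contrapT => NA; apply: Nt.
pose m := Num.floor (n%:R * t).
have /andP[mt tm] := floor_itv (n%:R * t).
have {}mt : m%:~R < n%:R * t.
  rewrite lt_neqAle mt andbT; apply/eqP => e; apply: NA; exists m => //.
  by rewrite e mulrC mulKf // gt_eqF.
have h : is_derive t 1 interpolation (n%:R *: (V (m + 1) - V m)).
  apply: near_eq_is_derive (is_derive_line (V m - m%:~R *: (V (m + 1) - V m)) _ t).
  near=> u; rewrite -interpolation_affine //; apply/andP; split.
    rewrite mulrC -ler_pdivrMr //; apply: ltW; near: u; apply: lt_nbhsr.
    by rewrite ltr_pdivrMr // mulrC.
  rewrite mulrC -ler_pdivlMr //; apply: ltW; near: u; apply: lt_nbhsl.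
  by rewrite ltr_pdivlMr // mulrC.
split; first exact: ex_derive.
rewrite derive_val enormZ ?ltW // /enorm -/(sqdist _ _) side.
by rewrite sqrtrV ?exprn_ge0 ?ltW // sqrtr_sqr gtr0_norm // mulfV // gt_eqF.
Unshelve. all: by end_near.
Qed.

Lemma interpolation_subdivision :
  subdivision n interpolation (fun i => i%:R / n%:R).
Proof.
split=> i.
- by rewrite ltr_pM2r ?invr_gt0 // ltr_nat.
- by rewrite natrD mulrDl divff // gt_eqF.
- rewrite -(natr1 i) mulrDl mul1r -[X in circle_dist _ X]addr0 circle_distDD.
  exact: circle_dist_step.
- exists (V i - i%:~R *: (V (i%:Z + 1) - V i)), (n%:R *: (V (i%:Z + 1) - V i)).
  move=> u /andP[u1 u2]; apply: interpolation_affine; apply/andP; split.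
    by rewrite mulrC -ler_pdivrMr.
  by rewrite mulrC -ler_pdivlMr // intrD -pmulrn natr1.
Qed.

Lemma interpolation_polygon : equilateral_polygon n d interpolation.
Proof.
split; [split|exact: interpolation_unit_speed|].
- exact: interpolation_continuous.
- move=> t; rewrite /interpolation mulrDr mulr1.
  have -> : Num.floor (n%:R * t + n%:R : R) = Num.floor (n%:R * t) + n%:Z.
    by rewrite floorDrz ?intr_nat // -[n%:R]/((n%:Z)%:~R) intrKfloor.
  rewrite Vn (_ : _ + n%:Z + 1 = Num.floor (n%:R * t) + 1 + n%:Z); last by ring.
  by rewrite Vn intrD -pmulrn; congr (_ + _ *: _); ring.
- by exists (fun i => i%:R / n%:R); exact: interpolation_subdivision.
Qed.

End PiecewiseAffine.

(** * Existence of a regular polygon, and conclusion *)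

Lemma exists_regular_polygon {R : realType} (n d : nat) :
  (3 <= n)%N -> (2 <= d)%N ->
  exists (p : R -> 'rV[R]_d) (a : nat -> R),
    [/\ equilateral_polygon n d p, subdivision n p a & chords_regular n (p \o a)].
Proof.
case: d => [//|[//|d]] n3 _.
pose e : 'rV[R]_d.+2 := delta_mx 0 ord0; pose f : 'rV[R]_d.+2 := delta_mx 0 ord_max.
have ee : edot e e = 1.
  rewrite /edot (bigD1 ord0) //= big1 => [|i /negPf i0].
    by rewrite !mxE !eqxx mulr1 addr0.
  by rewrite !mxE i0 andbF mul0r.
have ff : edot f f = 1.
  rewrite /edot (bigD1 ord_max) //= big1 => [|i /negPf i0].
    by rewrite !mxE !eqxx mulr1 addr0.
  by rewrite !mxE i0 andbF mul0r.
have ef : edot e f = 0.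
  rewrite /edot big1 // => i _; rewrite !mxE /=.
  by have [->|] := eqVneq i ord0; rewrite ?mulr0 ?mul0r.
pose h : R := pi / n%:R.
have nR : (0 : R) < n%:R by rewrite ltr0n; lia.
have sh : 0 < sin h by rewrite -[h]mul1r (@sin_angle_gt0 _ n 1) //; lia.
(* The circumradius that gives sides of length [1 / n]. *)
pose r : R := (2 * n%:R * sin h)^-1.
pose V (k : int) := 0 + (r * cos (2 * h * k%:~R)) *: e + (r * sin (2 * h * k%:~R)) *: f.
(* The integer base point [k] also covers the sides at negative indices. *)
have chord (k : int) (i j : nat) : sqdist (V (k + i%:Z)) (V (k + j%:Z)) =
    regular_sqchord n (j%:R - i%:R).
  rewrite planar_sqdist //.
  pose x (i : nat) := r * cos (2 * h * (k + i%:Z)%:~R).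
  pose y (i : nat) := r * sin (2 * h * (k + i%:Z)%:~R).
  have xy : circle_points h x y (r * cos (2 * h * k%:~R)) (r * sin (2 * h * k%:~R)).
    exists 0, 0 => l; rewrite /x /y intrD mulrDr -pmulrn cosD sinD.
    by split; ring.
  rewrite -/(x i) -/(x j) -/(y i) -/(y j) (circle_points_sqdist _ _ xy).
  rewrite (_ : _ + _ = r ^+ 2 * (cos (2 * h * k%:~R) ^+ 2 + sin (2 * h * k%:~R) ^+ 2));
    last by ring.
  rewrite cos2Dsin2 /regular_sqchord -/h [_ * h]mulrC /r; field.
  by rewrite !gt_eqF.
have side k : sqdist (V k) (V (k + 1)) = n%:R ^- 2.
  by rewrite -{1}[k]addr0 (chord k 0%N 1%N) subr0 regular_sqchord1 //; lia.
have Vn k : V (k + n%:Z) = V k.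
  rewrite /V intrD (_ : 2 * h * _ = 2 * h * k%:~R + pi *+ 2).
    by rewrite sinD2pi cosD2pi.
  by rewrite mulrDr /h -[pi *+ 2]mulr_natl -pmulrn; field; rewrite gt_eqF.
have n1 : (1 < n)%N by lia.
exists (interpolation n V), (fun i => i%:R / n%:R); split.
- exact: interpolation_polygon.
- exact: interpolation_subdivision.
- move=> i j /=.
  rewrite -[i%:R]/((i%:Z)%:~R) -[j%:R]/((j%:Z)%:~R) !interpolation_vertex //.
  by rewrite -[i%:Z]add0r -[j%:Z]add0r chord !add0r.
Qed.

Theorem lemma5 (R : realType) (n d : nat) (hn : (3 <= n)%N) (hd : (2 <= d)%N) :
  (exists p : R -> 'rV[R]_d,
     is_minimizer (mobius_energy n) (equilateral_polygon n d) p) /\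
  (forall p : R -> 'rV[R]_d,
     is_minimizer (mobius_energy n) (equilateral_polygon n d) p <->
     regular_ngon n d p).
Proof.
have n1 : (1 < n)%N by lia.
have n0 : (0 < n)%N by lia.
have minE (q : R -> 'rV[R]_d) : equilateral_polygon n d q ->
    ((regular_energy n)%:E <= mobius_energy n q)%E.
  by move=> qP; have [_ _ [b sb]] := qP; rewrite (mobius_energyE n0 qP sb) mobius_energy_ge.
have minP (p : R -> 'rV[R]_d) a : equilateral_polygon n d p -> subdivision n p a ->
    chords_regular n (p \o a) ->
    is_minimizer (mobius_energy n) (equilateral_polygon n d) p.
  move=> pP sa pa; split=> // q qP.
  by rewrite (mobius_energyE n0 pP sa) (mobius_energy_regular n1 sa) // minE.
have [p0 [a0 [p0P sa0 reg0]]] := @exists_regular_polygon R n d hn hd.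
split; first by exists p0; exact: minP reg0.
move=> p; split=> [[pP pmin]|[pP [a [sa pa]]]].
- split=> //; have [_ _ [a sa]] := pP; exists a; split=> //.
  apply: (chords_regular_vertices hn).
  (* The energy of a minimizer is at most that of [p0], which is [regular_energy n], so the equality
     case applies. *)
  apply: (mobius_energy_le_regular n1 pP sa).
  rewrite -(mobius_energyE n0 pP sa) (le_trans (pmin _ p0P)) //.
  by rewrite (mobius_energyE n0 p0P sa0) (mobius_energy_regular n1 sa0).
- apply: (minP p a) => //; apply: regular_vertices_chords => //.
    exact: (vertices_periodic pP sa).
  exact: (sqdist_side n1 pP sa).
Qed.
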